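(* Let $n$ be a positive integer and let $u:\{-n,\dots,n\}\to\mathbb{R}$ satisfy $u(j)=u(-j)$ for all $j$, $\sum_{j=-n}^{n}u(j)=1$, and $\widehat{u}(\xi)\ge 0$ for all $\xi\in\mathbb{T}$. Then $$\sup_{0\neq f\in\ell^2(\mathbb{Z})}\frac{\|\nabla^{4}(u\ast f)\|_{\ell^2(\mathbb{Z})}}{\|f\|_{\ell^2(\mathbb{Z})}}\ \ge\ \frac{2^6}{(n+2)^2}\tan^2\!\left(\frac{\pi}{2n+4}\right).$$ Moreover, equality holds if and only if for every $m\in\{0,\dots,n\}$, $$u(m)=u(-m)=\frac{1}{\pi}\int_{-1}^{1}S_n(x)T_m(x)\frac{dx}{\sqrt{1-x^2}},$$ where $$S_n(x)=\frac{8}{(n+2)^2}\tan^2\!\left(\frac{\pi}{2n+4}\right)\frac{1}{(1-x)^2}\left(1+T_{n+2}\!\left(\frac{1+\cos(\pi/(n+2))}{2}(x+1)-1\right)\right)$$ (a polynomial of degree $n$).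
   Context: Functions on $\{-n,\dots,n\}$ are regarded as functions on $\mathbb{Z}$ vanishing outside it. $\nabla g(k)=g(k+1)-g(k)$, $\nabla^{\ell}=\nabla(\nabla^{\ell-1})$; $(u\ast f)(k)=\sum_j u(j)f(k-j)$; $\mathbb{T}=\mathbb{R}/2\pi\mathbb{Z}$; $\widehat{u}(\xi)=\sum_k u(k)e^{-ik\xi}$. $T_m$ denotes the Chebyshev polynomial of the first kind of degree $m$, $T_m(\cos\theta)=\cos(m\theta)$. The supremum is over nonzero $f\in\ell^2(\mathbb{Z})$. *)

(* Defs.v *)
From Stdlib Require Import Reals ZArith.
From Coquelicot Require Import Coquelicot.
Open Scope R_scope.

Definition zsumC (a : Z) (len : nat) (g : Z -> C) : C :=
  match len with
  | O => RtoC 0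
  | S l => sum_n_m (fun i => g (a + Z.of_nat i)%Z) 0 l
  end.

Definition zsumR (a : Z) (len : nat) (g : Z -> R) : R :=
  match len with
  | O => 0
  | S l => sum_n_m (fun i => g (a + Z.of_nat i)%Z) 0 l
  end.

Definition sym_sum (n : nat) (u : Z -> R) : R := zsumR (- Z.of_nat n) (2 * n + 1) u.

(* Fourier transform of u supported in {-n..n}: \hat u(xi) = sum_k u(k) e^{-i k xi} *)
Definition fourier (n : nat) (u : Z -> R) (xi : R) : C :=
  zsumC (- Z.of_nat n) (2 * n + 1)
    (fun k => Cmult (RtoC (u k)) (cos (- IZR k * xi), sin (- IZR k * xi))).

(* convolution (u * f)(k) = sum_j u(j) f(k-j); u vanishes outside {-n..n} *)
Definition conv (n : nat) (u : Z -> R) (f : Z -> C) (k : Z) : C :=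
  zsumC (- Z.of_nat n) (2 * n + 1) (fun j => Cmult (RtoC (u j)) (f (k - j)%Z)).

Definition nabla (g : Z -> C) (k : Z) : C := Cminus (g (k + 1)%Z) (g k).
Fixpoint nabla_pow (l : nat) (g : Z -> C) : Z -> C :=
  match l with
  | O => g
  | S l' => nabla (nabla_pow l' g)
  end.

Definition in_l2 (f : Z -> C) : Prop :=
  ex_series (fun k : nat => (Cmod (f (Z.of_nat k)))^2) /\
  ex_series (fun k : nat => (Cmod (f (- Z.of_nat (S k))%Z))^2).

Definition l2norm (f : Z -> C) : R :=
  sqrt (Series (fun k : nat => (Cmod (f (Z.of_nat k)))^2) +
        Series (fun k : nat => (Cmod (f (- Z.of_nat (S k))%Z))^2)).

Definition opnorm4 (n : nat) (u : Z -> R) : Rbar :=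
  Lub_Rbar (fun r => exists f : Z -> C, in_l2 f /\ (exists k, f k <> RtoC 0) /\
                     r = l2norm (nabla_pow 4 (conv n u f)) / l2norm f).

Fixpoint chebT (m : nat) (x : R) : R :=
  match m with
  | O => 1
  | S m' => match m' with
            | O => x
            | S m'' => 2 * x * chebT m' x - chebT m'' x
            end
  end.

Definition Sn (n : nat) (x : R) : R :=
  8 / (INR n + 2)^2 * (tan (PI / (2 * INR n + 4)))^2 * (1 / (1 - x)^2) *
  (1 + chebT (n + 2) ((1 + cos (PI / (INR n + 2))) / 2 * (x + 1) - 1)).

Definition coef (n m : nat) : R :=
  / PI * RInt_gen (fun x => Sn n x * chebT m x / sqrt (1 - x^2))
                  (at_right (-1)) (at_left 1).

(* Main.v *)
(** Write [U(xi)] for the cosine polynomial [sum_j u(j) cos(j xi)].  The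
    operator [f |-> nabla^4 (u * f)] multiplies Fourier transforms by a function
    of modulus [4 (1 - cos xi)^2 U(xi)], so its norm is the maximum [M] of this
    symbol: truncated exponentials show that the norm is at least [M], and
    Parseval's identity for a discrete Fourier transform of period larger than a
    window bounds the output on that window.  With [x = cos xi] and [U(xi) = p(x)],
    the problem becomes to minimise the maximum of [4 (1 - x)^2 p(x)] on [[-1, 1]]
    over polynomials [p >= 0] of degree at most [n] with [p(1) = 1].  For [p = S_n]
    this weighted polynomial is a multiple of [1 + T_(n+2)(a (x + 1) - 1)], which
    equioscillates between 0 and its maximum at [n + 1] points of [[-1, 1)].  If
    [p] does at least as well, [p - S_n] vanishes at 1 and has weakly alternating
    signs at these points; its divided difference over the [n + 2] points is zero
    although all terms have the same sign, hence [p = S_n].  The coefficients of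
    [S_n] are recovered by the substitution [x = cos xi]. *)
Require Import Defs.
From Stdlib Require Import Reals ZArith Lra Lia.
From Coquelicot Require Import Coquelicot.
Open Scope R_scope.

(** * Sums over integer windows and the discrete Parseval identity *)

Lemma zsumR_S (a : Z) (l : nat) (g : Z -> R) :
  zsumR a (S l) g = zsumR a l g + g (a + Z.of_nat l)%Z.
Proof.
  destruct l as [|l].
  - unfold zsumR. rewrite sum_n_n. ring.
  - unfold zsumR. rewrite sum_n_Sm by lia. reflexivity.
Qed.

Lemma zsumR_ext (a : Z) (l : nat) (g h : Z -> R) :
  (forall k, (a <= k < a + Z.of_nat l)%Z -> g k = h k) ->
  zsumR a l g = zsumR a l h.
Proof.
  induction l as [|l IH]; intros H; [reflexivity|].
  rewrite !zsumR_S, IH, H by (intros; try apply H; lia). reflexivity.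
Qed.

Lemma zsumR_plus (a : Z) (l : nat) (g h : Z -> R) :
  zsumR a l (fun k => g k + h k) = zsumR a l g + zsumR a l h.
Proof.
  induction l as [|l IH]; [simpl; ring|].
  rewrite !zsumR_S, IH. ring.
Qed.

Lemma zsumR_scal (a : Z) (l : nat) (c : R) (g : Z -> R) :
  zsumR a l (fun k => c * g k) = c * zsumR a l g.
Proof.
  induction l as [|l IH]; [simpl; ring|].
  rewrite !zsumR_S, IH. ring.
Qed.

Lemma zsumR_const (a : Z) (l : nat) (c : R) :
  zsumR a l (fun _ => c) = INR l * c.
Proof.
  induction l as [|l IH]; [simpl; ring|].
  rewrite zsumR_S, IH, S_INR. ring.
Qed.

Lemma zsumR_zero (a : Z) (l : nat) (g : Z -> R) :
  (forall k, (a <= k < a + Z.of_nat l)%Z -> g k = 0) -> zsumR a l g = 0.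
Proof.
  intros H. rewrite (zsumR_ext a l g (fun _ => 0) H), zsumR_const. ring.
Qed.

Lemma zsumR_le (a : Z) (l : nat) (g h : Z -> R) :
  (forall k, (a <= k < a + Z.of_nat l)%Z -> g k <= h k) ->
  zsumR a l g <= zsumR a l h.
Proof.
  induction l as [|l IH]; intros H; [simpl; lra|].
  rewrite !zsumR_S. apply Rplus_le_compat; [apply IH; intros|]; apply H; lia.
Qed.

Lemma zsumR_exchange (a b : Z) (l m : nat) (g : Z -> Z -> R) :
  zsumR a l (fun i => zsumR b m (fun j => g i j)) =
  zsumR b m (fun j => zsumR a l (fun i => g i j)).
Proof.
  induction l as [|l IH].
  - symmetry. apply zsumR_zero. reflexivity.
  - rewrite zsumR_S, IH, <- zsumR_plus. apply zsumR_ext. intros.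
    now rewrite zsumR_S.
Qed.

Lemma zsumR_cat (a : Z) (l m : nat) (g : Z -> R) :
  zsumR a (l + m) g = zsumR a l g + zsumR (a + Z.of_nat l) m g.
Proof.
  induction m as [|m IH].
  - rewrite Nat.add_0_r. simpl. ring.
  - rewrite Nat.add_succ_r, !zsumR_S, IH, Nat2Z.inj_add, Z.add_assoc. ring.
Qed.

Lemma zsumR_shift (a c : Z) (l : nat) (g : Z -> R) :
  zsumR a l (fun k => g (k + c)%Z) = zsumR (a + c) l g.
Proof.
  induction l as [|l IH]; [reflexivity|].
  rewrite !zsumR_S, IH. do 2 f_equal. lia.
Qed.

Lemma zsumR_widen (a b : Z) (l m : nat) (g : Z -> R) :
  (b <= a)%Z -> (a + Z.of_nat l <= b + Z.of_nat m)%Z ->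
  (forall k, ~ (a <= k < a + Z.of_nat l)%Z -> g k = 0) ->
  zsumR b m g = zsumR a l g.
Proof.
  intros Hab Hlm H0.
  replace m with (Z.to_nat (a - b) + (l + (m - l - Z.to_nat (a - b))))%nat by lia.
  rewrite !zsumR_cat.
  replace (b + Z.of_nat (Z.to_nat (a - b)))%Z with a by lia.
  rewrite (zsumR_zero b), (zsumR_zero (a + Z.of_nat l)) by (intros; apply H0; lia).
  ring.
Qed.

(** Both sums are compared with the sum over the least window containing the two. *)
Lemma zsumR_window (a b : Z) (l m : nat) (g : Z -> R) :
  (forall k, ~ (a <= k < a + Z.of_nat l)%Z -> g k = 0) ->
  (forall k, ~ (b <= k < b + Z.of_nat m)%Z -> g k = 0) ->
  zsumR b m g = zsumR a l g.
Proof.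
  intros Ha Hb.
  set (c := Z.min a b).
  set (p := Z.to_nat (Z.max (a + Z.of_nat l) (b + Z.of_nat m) - c)).
  transitivity (zsumR c p g); [symmetry|]; apply zsumR_widen; subst c p; try assumption; lia.
Qed.

Lemma zsumR_delta (a : Z) (l : nat) (i : Z) (g : Z -> R) :
  (a <= i < a + Z.of_nat l)%Z ->
  zsumR a l (fun k => if Z.eq_dec k i then g k else 0) = g i.
Proof.
  intros Hi.
  rewrite (zsumR_widen i a 1 l); try lia.
  - rewrite zsumR_S. simpl. rewrite Z.add_0_r.
    destruct (Z.eq_dec i i); [ring|easy].
  - intros k Hk. destruct (Z.eq_dec k i); [lia|reflexivity].
Qed.

Lemma sym_sum_flip (l : nat) (g : Z -> R) :
  sym_sum l (fun k => g (- k)%Z) = sym_sum l g.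
Proof.
  unfold sym_sum. induction l as [|l IH].
  - unfold zsumR. simpl. rewrite !sum_n_n. reflexivity.
  (* The two outermost terms are split off, because the window grows at both ends when [l]
     increases. *)
  - assert (E : forall h, zsumR (- Z.of_nat (S l)) (2 * S l + 1) h =
       h (- Z.of_nat (S l))%Z + zsumR (- Z.of_nat l) (2 * l + 1) h + h (Z.of_nat (S l))).
    { intros h. replace (2 * S l + 1)%nat with (1 + ((2 * l + 1) + 1))%nat by lia.
      rewrite !zsumR_cat, !zsumR_S. simpl (zsumR _ 0 _).
      replace (- Z.of_nat (S l) + Z.of_nat 1)%Z with (- Z.of_nat l)%Z by lia.
      replace (- Z.of_nat (S l) + Z.of_nat 0)%Z with (- Z.of_nat (S l))%Z by lia.
      replace (- Z.of_nat l + Z.of_nat (2 * l + 1) + Z.of_nat 0)%Z with (Z.of_nat (S l)) by lia.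
      ring. }
    rewrite !E, IH, Z.opp_involutive. ring.
Qed.

(** Vanishing beyond [P - |c|] places the support inside both [{-P..P}] and its translate by [c]. *)
Lemma sym_sum_shift (P : nat) (c : Z) (g : Z -> R) :
  (forall k, (Z.abs k > Z.of_nat P - Z.abs c)%Z -> g k = 0) ->
  sym_sum P (fun k => g (k + c)%Z) = sym_sum P g.
Proof.
  intros H. unfold sym_sum. rewrite zsumR_shift.
  apply zsumR_window; intros; apply H; lia.
Qed.

Lemma sym_sum_widen (P Q : nat) (g : Z -> R) :
  (P <= Q)%nat -> (forall k, (Z.abs k > Z.of_nat P)%Z -> g k = 0) ->
  sym_sum Q g = sym_sum P g.
Proof.
  intros HPQ H. unfold sym_sum. apply zsumR_widen; intros; try apply H; lia.
Qed.

(* Multiplying by [2 sin (t/2)] makes the sum telescope. *)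
Lemma root_of_unity_sum (L : nat) (d : Z) :
  (Z.abs d < Z.of_nat L)%Z ->
  zsumR 0 L (fun j => cos (IZR d * (2 * PI * IZR j / INR L))) =
  if Z.eq_dec d 0 then INR L else 0.
Proof.
  intros Hd.
  assert (HL : 0 < INR L) by (apply lt_0_INR; lia).
  destruct (Z.eq_dec d 0) as [->|Hd0].
  - rewrite (zsumR_ext _ _ _ (fun _ => 1)), zsumR_const; [ring|].
    intros. rewrite <- cos_0. f_equal. unfold Rdiv. ring.
  - set (t := IZR d * (2 * PI / INR L)).
    (* A zero here would make [d] a nonzero multiple of [L], against [|d| < L]. *)
    assert (Hs : sin (t / 2) <> 0).
    { intros E. apply sin_eq_0_0 in E as [k Ek].
      assert (E : IZR d = IZR k * INR L).
      { apply (Rmult_eq_reg_r (PI / INR L)).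
        - transitivity (t / 2); [unfold t; field; lra|]. rewrite Ek. field. lra.
        - pose proof PI_RGT_0. apply Rgt_not_eq, Rdiv_lt_0_compat; lra. }
      rewrite INR_IZR_INZ, <- mult_IZR in E. apply eq_IZR in E.
      assert (k <> 0)%Z by lia. nia. }
    apply (Rmult_eq_reg_l (2 * sin (t / 2))); [|lra].
    assert (T : forall l, 2 * sin (t / 2) * zsumR 0 l (fun j => cos (IZR d * (2 * PI * IZR j / INR L))) =
      sin (t * INR l - t / 2) + sin (t / 2)).
    { induction l as [|l IH].
      - simpl. replace (t * 0 - t / 2) with (- (t / 2)) by ring. rewrite sin_neg. ring.
      - rewrite zsumR_S, Rmult_plus_distr_l, IH.
        replace (IZR d * (2 * PI * IZR (0 + Z.of_nat l) / INR L)) with (t * INR l)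
          by (unfold t; rewrite Z.add_0_l, <- INR_IZR_INZ; field; lra).
        replace (t * INR (S l) - t / 2) with (t * INR l + t / 2) by (rewrite S_INR; field).
        rewrite sin_plus, sin_minus. ring. }
    rewrite T.
    (* At [l = L] the first sine has argument [-(t/2)] plus [d] full turns, so it cancels the
       second. *)
    replace (t * INR L - t / 2) with (- (t / 2) + 2 * IZR d * PI) by (unfold t; field; lra).
    assert (P : forall (z : Z) x, sin (x + 2 * IZR z * PI) = sin x).
    { intros z x. rewrite (sin_plus x), <- (Rmult_comm PI).
      replace (PI * (2 * IZR z)) with (2 * (IZR z * PI)) by ring.
      rewrite sin_2a, cos_2a_sin.
      assert (S0 : sin (IZR z * PI) = 0) by (apply sin_eq_0_1; now exists z).
      rewrite S0. ring. }
    rewrite P, sin_neg. ring.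
Qed.

(** [cos_sum] and [sin_sum] are the real part and minus the imaginary part of the Fourier transform
    of [h] on [{-P..P}], which keeps the analysis in real arithmetic. *)
Definition cos_sum (P : nat) (h : Z -> R) (xi : R) : R :=
  sym_sum P (fun k => h k * cos (IZR k * xi)).
Definition sin_sum (P : nat) (h : Z -> R) (xi : R) : R :=
  sym_sum P (fun k => h k * sin (IZR k * xi)).

Lemma zsumR_mult (a b : Z) (l m : nat) (g h : Z -> R) :
  zsumR a l g * zsumR b m h = zsumR a l (fun i => zsumR b m (fun j => g i * h j)).
Proof.
  rewrite Rmult_comm, <- zsumR_scal. apply zsumR_ext. intros.
  rewrite zsumR_scal. ring.
Qed.

(** The number of frequencies equals the window length, so distinct indices differ by less than [L]
    and orthogonality leaves only the diagonal of the double sum. *)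
Lemma parseval (P : nat) (h : Z -> R) :
  let L := (2 * P + 1)%nat in
  zsumR 0 L (fun j => (cos_sum P h (2 * PI * IZR j / INR L))^2
                     + (sin_sum P h (2 * PI * IZR j / INR L))^2) =
  INR L * sym_sum P (fun k => (h k)^2).
Proof.
  intros L.
  transitivity (zsumR 0 L (fun j => zsumR (- Z.of_nat P) L (fun k => zsumR (- Z.of_nat P) L
     (fun l => h k * h l * cos (IZR (l - k) * (2 * PI * IZR j / INR L)))))).
  { apply zsumR_ext. intros j _. unfold cos_sum, sin_sum, sym_sum. fold L.
    set (xi := 2 * PI * IZR j / INR L). simpl. rewrite !Rmult_1_r, !zsumR_mult, <- zsumR_plus.
    apply zsumR_ext. intros k _. rewrite <- zsumR_plus. apply zsumR_ext. intros l _.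
    rewrite minus_IZR, Rmult_minus_distr_r, cos_minus. ring. }
  rewrite zsumR_exchange. unfold sym_sum. fold L. rewrite <- (zsumR_scal _ _ (INR L)).
  apply zsumR_ext. intros k Hk. rewrite zsumR_exchange.
  rewrite <- (zsumR_delta (- Z.of_nat P) L k (fun l => INR L * (h l)^2)) by lia.
  apply zsumR_ext. intros l Hl.
  rewrite zsumR_scal, root_of_unity_sum by lia.
  destruct (Z.eq_dec l k) as [->|Hlk].
  - rewrite Z.sub_diag. simpl. ring.
  - destruct (Z.eq_dec (l - k) 0); [lia|ring].
Qed.

(** * The operator and its symbol *)

(** Since [u] is real, the operator acts separately on real and imaginary parts; [rconv], [rnabla]
    and [rop] are its real versions. *)
Definition rconv (n : nat) (u h : Z -> R) (k : Z) : R :=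
  sym_sum n (fun j => u j * h (k - j)%Z).
Definition rnabla (h : Z -> R) (k : Z) : R := h (k + 1)%Z - h k.
Definition rop (n : nat) (u h : Z -> R) : Z -> R :=
  rnabla (rnabla (rnabla (rnabla (rconv n u h)))).

Definition supported (P : nat) (h : Z -> R) : Prop :=
  forall k, (Z.abs k > Z.of_nat P)%Z -> h k = 0.

Lemma zsumC_S (a : Z) (l : nat) (g : Z -> C) :
  zsumC a (S l) g = Cplus (zsumC a l g) (g (a + Z.of_nat l)%Z).
Proof.
  destruct l as [|l].
  - unfold zsumC. rewrite sum_n_n. symmetry. apply Cplus_0_l.
  - unfold zsumC. rewrite sum_n_Sm by lia. reflexivity.
Qed.

Lemma zsumC_fst (a : Z) (l : nat) (g : Z -> C) :
  fst (zsumC a l g) = zsumR a l (fun k => fst (g k)).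
Proof.
  induction l as [|l IH]; [reflexivity|]. now rewrite zsumC_S, zsumR_S, <- IH.
Qed.

Lemma zsumC_snd (a : Z) (l : nat) (g : Z -> C) :
  snd (zsumC a l g) = zsumR a l (fun k => snd (g k)).
Proof.
  induction l as [|l IH]; [reflexivity|]. now rewrite zsumC_S, zsumR_S, <- IH.
Qed.

Lemma conv_fst (n : nat) (u : Z -> R) (f : Z -> C) (k : Z) :
  fst (conv n u f k) = rconv n u (fun j => fst (f j)) k.
Proof.
  unfold conv, rconv, sym_sum. rewrite zsumC_fst. apply zsumR_ext. intros. simpl. ring.
Qed.

Lemma conv_snd (n : nat) (u : Z -> R) (f : Z -> C) (k : Z) :
  snd (conv n u f k) = rconv n u (fun j => snd (f j)) k.
Proof.
  unfold conv, rconv, sym_sum. rewrite zsumC_snd. apply zsumR_ext. intros. simpl. ring.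
Qed.

Lemma Cmod_sqr (z : C) : (Cmod z)^2 = (fst z)^2 + (snd z)^2.
Proof.
  unfold Cmod. rewrite pow2_sqrt; [reflexivity|]. nra.
Qed.

Lemma Cmod_nabla4_conv (n : nat) (u : Z -> R) (f : Z -> C) (k : Z) :
  (Cmod (nabla_pow 4 (conv n u f) k))^2 =
  (rop n u (fun j => fst (f j)) k)^2 + (rop n u (fun j => snd (f j)) k)^2.
Proof.
  rewrite Cmod_sqr. unfold rop, rnabla. rewrite <- !conv_fst, <- !conv_snd.
  simpl. unfold nabla, Cminus, Cplus, Copp, Rminus. simpl. reflexivity.
Qed.

(** The four forward differences read [k] to [k + 4], and the convolution reaches [n] further on
    each side. *)
Lemma rop_local (n : nat) (u h h' : Z -> R) (k : Z) :
  (forall j, (k - Z.of_nat n <= j <= k + Z.of_nat n + 4)%Z -> h j = h' j) ->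
  rop n u h k = rop n u h' k.
Proof.
  intros H.
  assert (E : forall j, (k <= j <= k + 4)%Z -> rconv n u h j = rconv n u h' j).
  { intros j Hj. unfold rconv, sym_sum. apply zsumR_ext. intros i Hi.
    rewrite H by lia. reflexivity. }
  unfold rop, rnabla. rewrite !E by lia. reflexivity.
Qed.

Lemma rconv_supported (n P : nat) (u h : Z -> R) :
  supported P h -> supported (P + n) (rconv n u h).
Proof.
  intros H k Hk. apply zsumR_zero. intros j Hj. rewrite H by lia. ring.
Qed.

Lemma rnabla_supported (P : nat) (h : Z -> R) :
  supported P h -> supported (P + 1) (rnabla h).
Proof.
  intros H k Hk. unfold rnabla. rewrite !H by lia. ring.
Qed.

(** The squared modulus of the Fourier transform. *)
Definition energy (P : nat) (h : Z -> R) (xi : R) : R :=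
  (cos_sum P h xi)^2 + (sin_sum P h xi)^2.

(** The window [Q] leaves room for the support of [h] moved by [c], so the translation passes to the
    weight without boundary terms. *)
Lemma sym_sum_shift_mult (P Q : nat) (c : Z) (h w : Z -> R) :
  supported P h -> (Z.of_nat P + Z.abs c <= Z.of_nat Q)%Z ->
  sym_sum Q (fun k => h (k + c)%Z * w k) = sym_sum Q (fun k => h k * w (k - c)%Z).
Proof.
  intros H HPQ. rewrite <- (sym_sum_shift Q c (fun k => h k * w (k - c)%Z)).
  - apply zsumR_ext. intros k _. do 2 f_equal. lia.
  - intros k Hk. rewrite H by lia. ring.
Qed.

(** Translation by [c] multiplies the transform by [exp(-i c xi)]; this is the real part, and
    [sin_sum_translate] gives the imaginary part. *)
Lemma cos_sum_translate (P Q : nat) (c : Z) (h : Z -> R) (xi : R) :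
  supported P h -> (Z.of_nat P + Z.abs c <= Z.of_nat Q)%Z ->
  cos_sum Q (fun k => h (k - c)%Z) xi =
  cos (IZR c * xi) * cos_sum Q h xi - sin (IZR c * xi) * sin_sum Q h xi.
Proof.
  intros H HPQ. unfold cos_sum at 1.
  etransitivity; [exact (sym_sum_shift_mult P Q (- c) h (fun k => cos (IZR k * xi)) H ltac:(lia))|].
  unfold cos_sum, sin_sum, sym_sum, Rminus. rewrite Ropp_mult_distr_l, <- !zsumR_scal, <- zsumR_plus.
  apply zsumR_ext. intros k _.
  rewrite Z.sub_opp_r, plus_IZR, Rmult_plus_distr_r, cos_plus. ring.
Qed.

Lemma sin_sum_translate (P Q : nat) (c : Z) (h : Z -> R) (xi : R) :
  supported P h -> (Z.of_nat P + Z.abs c <= Z.of_nat Q)%Z ->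
  sin_sum Q (fun k => h (k - c)%Z) xi =
  cos (IZR c * xi) * sin_sum Q h xi + sin (IZR c * xi) * cos_sum Q h xi.
Proof.
  intros H HPQ. unfold sin_sum at 1.
  etransitivity; [exact (sym_sum_shift_mult P Q (- c) h (fun k => sin (IZR k * xi)) H ltac:(lia))|].
  unfold cos_sum, sin_sum, sym_sum. rewrite <- !zsumR_scal, <- zsumR_plus.
  apply zsumR_ext. intros k _.
  rewrite Z.sub_opp_r, plus_IZR, Rmult_plus_distr_r, sin_plus. ring.
Qed.

Lemma cos_sum_minus (P : nat) (g h : Z -> R) (xi : R) :
  cos_sum P (fun k => g k - h k) xi = cos_sum P g xi - cos_sum P h xi.
Proof.
  unfold cos_sum, sym_sum. rewrite <- (Rmult_1_l (zsumR _ _ (fun k => h k * _))).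
  unfold Rminus. rewrite Ropp_mult_distr_l, <- zsumR_scal, <- zsumR_plus.
  apply zsumR_ext. intros. ring.
Qed.

Lemma sin_sum_minus (P : nat) (g h : Z -> R) (xi : R) :
  sin_sum P (fun k => g k - h k) xi = sin_sum P g xi - sin_sum P h xi.
Proof.
  unfold sin_sum, sym_sum. rewrite <- (Rmult_1_l (zsumR _ _ (fun k => h k * _))).
  unfold Rminus. rewrite Ropp_mult_distr_l, <- zsumR_scal, <- zsumR_plus.
  apply zsumR_ext. intros. ring.
Qed.

(** The factor is [|exp(i xi) - 1|^2]. *)
Lemma energy_rnabla (P Q : nat) (h : Z -> R) (xi : R) :
  supported P h -> (P + 1 <= Q)%nat ->
  energy Q (rnabla h) xi = 2 * (1 - cos xi) * energy Q h xi.
Proof.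
  intros H HPQ. unfold energy, rnabla. rewrite cos_sum_minus, sin_sum_minus.
  change (cos_sum Q (fun k => h (k + 1)%Z) xi) with (cos_sum Q (fun k => h (k - -1)%Z) xi).
  change (sin_sum Q (fun k => h (k + 1)%Z) xi) with (sin_sum Q (fun k => h (k - -1)%Z) xi).
  rewrite (cos_sum_translate P), (sin_sum_translate P) by (try assumption; lia).
  replace (-1 * xi) with (- xi) by ring. rewrite cos_neg, sin_neg.
  pose proof (sin2_cos2 xi) as E. unfold Rsqr in E.
  set (A := cos_sum Q h xi). set (B := sin_sum Q h xi).
  replace (2 * (1 - cos xi)) with (sin xi * sin xi + cos xi * cos xi + 1 - 2 * cos xi) by (rewrite E; ring).
  ring.
Qed.

Lemma sin_sum_even (n : nat) (u : Z -> R) (xi : R) :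
  (forall j, u j = u (- j)%Z) -> sin_sum n u xi = 0.
Proof.
  intros Hu.
  assert (E : sin_sum n u xi = - sin_sum n u xi); [|lra].
  unfold sin_sum at 1. rewrite <- sym_sum_flip. unfold sin_sum, sym_sum.
  rewrite <- (Rmult_1_l (zsumR _ _ (fun k => u k * _))), Ropp_mult_distr_l, <- zsumR_scal.
  apply zsumR_ext. intros k _. rewrite <- Hu, opp_IZR, <- Ropp_mult_distr_l, sin_neg. ring.
Qed.

(** The convolution theorem: the transform of the even [u] is real, so it scales real and imaginary
    parts alike. *)
Lemma cos_sum_rconv (n P Q : nat) (u h : Z -> R) (xi : R) :
  (forall j, u j = u (- j)%Z) -> supported P h -> (P + n <= Q)%nat ->
  cos_sum Q (rconv n u h) xi = cos_sum n u xi * cos_sum Q h xi.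
Proof.
  intros Hu H HPQ.
  transitivity (sym_sum n (fun j => u j * cos_sum Q (fun k => h (k - j)%Z) xi)).
  { transitivity (sym_sum Q (fun k => sym_sum n (fun j => u j * (h (k - j)%Z * cos (IZR k * xi))))).
    - apply zsumR_ext. intros k _. unfold rconv, sym_sum. rewrite Rmult_comm, <- zsumR_scal.
      apply zsumR_ext. intros. ring.
    - unfold sym_sum. rewrite zsumR_exchange. apply zsumR_ext. intros j _.
      rewrite zsumR_scal. reflexivity. }
  transitivity (cos_sum n u xi * cos_sum Q h xi - sin_sum n u xi * sin_sum Q h xi).
  (* The vanishing sine term is inserted so that the right side matches the translation formula term
     by term. *)
  2:{ rewrite (sin_sum_even n u xi Hu). ring. }
  rewrite (Rmult_comm (cos_sum n u xi)), (Rmult_comm (sin_sum n u xi)).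
  unfold Rminus. rewrite Ropp_mult_distr_l. unfold cos_sum at 3, sin_sum at 2, sym_sum.
  rewrite <- !zsumR_scal, <- zsumR_plus. apply zsumR_ext. intros j Hj.
  rewrite (cos_sum_translate P) by (try assumption; lia). ring.
Qed.

Lemma sin_sum_rconv (n P Q : nat) (u h : Z -> R) (xi : R) :
  (forall j, u j = u (- j)%Z) -> supported P h -> (P + n <= Q)%nat ->
  sin_sum Q (rconv n u h) xi = cos_sum n u xi * sin_sum Q h xi.
Proof.
  intros Hu H HPQ.
  transitivity (sym_sum n (fun j => u j * sin_sum Q (fun k => h (k - j)%Z) xi)).
  { transitivity (sym_sum Q (fun k => sym_sum n (fun j => u j * (h (k - j)%Z * sin (IZR k * xi))))).
    - apply zsumR_ext. intros k _. unfold rconv, sym_sum. rewrite Rmult_comm, <- zsumR_scal.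
      apply zsumR_ext. intros. ring.
    - unfold sym_sum. rewrite zsumR_exchange. apply zsumR_ext. intros j _.
      rewrite zsumR_scal. reflexivity. }
  transitivity (cos_sum n u xi * sin_sum Q h xi + sin_sum n u xi * cos_sum Q h xi).
  2:{ rewrite (sin_sum_even n u xi Hu). ring. }
  rewrite (Rmult_comm (cos_sum n u xi)), (Rmult_comm (sin_sum n u xi)).
  unfold cos_sum at 1, sin_sum at 3, sym_sum.
  rewrite <- !zsumR_scal, <- zsumR_plus. apply zsumR_ext. intros j Hj.
  rewrite (sin_sum_translate P) by (try assumption; lia). ring.
Qed.

(** Four differences contribute [|exp(i xi) - 1|^4 = 4 (1 - cos xi)^2]; the other factor is the
    transform of [u]. *)
Definition symbol (n : nat) (u : Z -> R) (xi : R) : R :=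
  4 * (1 - cos xi)^2 * cos_sum n u xi.

Lemma energy_rop (n P Q : nat) (u h : Z -> R) (xi : R) :
  (forall j, u j = u (- j)%Z) -> supported P h -> (P + n + 4 <= Q)%nat ->
  energy Q (rop n u h) xi = (symbol n u xi)^2 * energy Q h xi.
Proof.
  intros Hu H HPQ. unfold rop.
  pose proof (rconv_supported n P u h H) as H0.
  pose proof (rnabla_supported _ _ H0) as H1.
  pose proof (rnabla_supported _ _ H1) as H2.
  pose proof (rnabla_supported _ _ H2) as H3.
  rewrite (energy_rnabla _ _ _ _ H3), (energy_rnabla _ _ _ _ H2),
    (energy_rnabla _ _ _ _ H1), (energy_rnabla _ _ _ _ H0) by lia.
  unfold energy. rewrite (cos_sum_rconv n P Q), (sin_sum_rconv n P Q) by (try assumption; lia).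
  unfold symbol. ring.
Qed.

(** The period [2Q + 1] holds the whole output, so Parseval applies to input and output and the
    bound holds frequency by frequency. *)
Lemma rop_bound_finite (n P Q : nat) (u h : Z -> R) (M : R) :
  (forall j, u j = u (- j)%Z) -> (forall xi, 0 <= symbol n u xi <= M) ->
  supported P h -> (P + n + 4 <= Q)%nat ->
  sym_sum Q (fun k => (rop n u h k)^2) <= M^2 * sym_sum P (fun k => (h k)^2).
Proof.
  intros Hu HM H HPQ.
  rewrite <- (sym_sum_widen P Q) by (try lia; intros k Hk; rewrite H by lia; ring).
  pose proof (parseval Q (rop n u h)) as E1. pose proof (parseval Q h) as E2.
  cbv zeta in E1, E2.
  assert (HL : 0 < INR (2 * Q + 1)) by (apply lt_0_INR; lia).
  apply (Rmult_le_reg_l (INR (2 * Q + 1))); [exact HL|].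
  rewrite <- Rmult_assoc, (Rmult_comm _ (M^2)), Rmult_assoc, <- E1, <- E2, <- zsumR_scal.
  apply zsumR_le. intros j _. set (xi := 2 * PI * IZR j / INR (2 * Q + 1)).
  fold (energy Q (rop n u h) xi). fold (energy Q h xi).
  rewrite (energy_rop n P Q) by assumption.
  apply Rmult_le_compat_r.
  - unfold energy. nra.
  - specialize (HM xi). apply pow_incr. exact HM.
Qed.

(** * Two-sided series with nonnegative terms *)

Definition bisum (g : Z -> R) : R :=
  Series (fun k : nat => g (Z.of_nat k)) + Series (fun k : nat => g (- Z.of_nat (S k))%Z).

Definition bisummable (g : Z -> R) : Prop :=
  ex_series (fun k : nat => g (Z.of_nat k)) /\ ex_series (fun k : nat => g (- Z.of_nat (S k))%Z).

Lemma sum_n_S (a : nat -> R) (K : nat) : sum_n a (S K) = sum_n a K + a (S K).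
Proof. exact (sum_Sn a K). Qed.

(** The negative half starts at [-1], so its [K + 1] terms reach one index beyond the symmetric
    window. *)
Lemma half_sums (g : Z -> R) (K : nat) :
  sum_n (fun k => g (Z.of_nat k)) K + sum_n (fun k => g (- Z.of_nat (S k))%Z) K =
  sym_sum K g + g (- Z.of_nat (S K))%Z.
Proof.
  induction K as [|K IH].
  - rewrite !sum_O. unfold sym_sum. simpl Nat.add. rewrite zsumR_S. simpl. ring.
  - rewrite !sum_n_S.
    transitivity (sym_sum K g + g (- Z.of_nat (S K))%Z + g (Z.of_nat (S K)) + g (- Z.of_nat (S (S K)))%Z).
    { rewrite <- IH. ring. }
    f_equal. unfold sym_sum.
    replace (2 * S K + 1)%nat with (1 + ((2 * K + 1) + 1))%nat by lia.
    rewrite !zsumR_cat, !zsumR_S. simpl (zsumR _ 0 _).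
    replace (- Z.of_nat (S K) + Z.of_nat 1)%Z with (- Z.of_nat K)%Z by lia.
    replace (- Z.of_nat (S K) + Z.of_nat 0)%Z with (- Z.of_nat (S K))%Z by lia.
    replace (- Z.of_nat K + Z.of_nat (2 * K + 1) + Z.of_nat 0)%Z with (Z.of_nat (S K)) by lia.
    ring.
Qed.

Lemma sum_n_nonneg_le_Series (a : nat -> R) (K : nat) :
  (forall k, 0 <= a k) -> ex_series a -> sum_n a K <= Series a.
Proof.
  intros Ha He. apply (is_lim_seq_incr_compare (sum_n a)).
  - apply Series_correct, He.
  - intros m. rewrite sum_n_S. specialize (Ha (S m)). lra.
Qed.

Lemma ex_series_nonneg_bounded (a : nat -> R) (B : R) :
  (forall k, 0 <= a k) -> (forall K, sum_n a K <= B) -> ex_series a.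
Proof.
  intros Ha HB. destruct (ex_finite_lim_seq_incr (sum_n a) B) as [l Hl].
  - intros m. rewrite sum_n_S. specialize (Ha (S m)). lra.
  - exact HB.
  - exists l. exact Hl.
Qed.

Lemma sym_sum_le_bisum (g : Z -> R) (K : nat) :
  (forall k, 0 <= g k) -> bisummable g -> sym_sum K g <= bisum g.
Proof.
  intros Hg [H1 H2]. pose proof (half_sums g K) as E.
  pose proof (sum_n_nonneg_le_Series _ K (fun k => Hg (Z.of_nat k)) H1).
  pose proof (sum_n_nonneg_le_Series _ K (fun k => Hg (- Z.of_nat (S k))%Z) H2).
  pose proof (Hg (- Z.of_nat (S K))%Z). unfold bisum. simpl in *. lra.
Qed.

Lemma sum_n_nonneg (a : nat -> R) (K : nat) : (forall k, 0 <= a k) -> 0 <= sum_n a K.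
Proof.
  intros Ha. induction K as [|K IH]; [now rewrite sum_O|].
  rewrite sum_n_S. specialize (Ha (S K)). lra.
Qed.

Lemma bisum_bounded (g : Z -> R) (B : R) :
  (forall k, 0 <= g k) -> (forall K, sym_sum K g <= B) -> bisummable g /\ bisum g <= B.
Proof.
  intros Hg HB.
  set (a := fun k : nat => g (Z.of_nat k)). set (b := fun k : nat => g (- Z.of_nat (S k))%Z).
  assert (Hab : forall K, sum_n a K + sum_n b K <= B).
  (* Both half sums up to [K] fit into the symmetric window of radius [K + 1]. *)
  { intros K. eapply Rle_trans; [|apply (HB (S K))]. unfold a, b. rewrite half_sums.
    pose proof (half_sums g (S K)) as E. rewrite !sum_n_S, <- (Rplus_assoc _ _ (g _)) in E.
    pose proof (half_sums g K) as E'. pose proof (Hg (Z.of_nat (S K))). lra. }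
  assert (Ha0 : forall k, 0 <= a k) by (intros; apply Hg).
  assert (Hb0 : forall k, 0 <= b k) by (intros; apply Hg).
  assert (Ea : ex_series a).
  { apply (ex_series_nonneg_bounded a B Ha0). intros K.
    specialize (Hab K). pose proof (sum_n_nonneg b K Hb0). lra. }
  assert (Eb : ex_series b).
  { apply (ex_series_nonneg_bounded b B Hb0). intros K.
    specialize (Hab K). pose proof (sum_n_nonneg a K Ha0). lra. }
  split; [split; assumption|].
  apply (is_lim_seq_le (fun K => sum_n a K + sum_n b K) (fun _ => B) (bisum g) B Hab).
  - apply is_lim_seq_plus'; apply Series_correct; assumption.
  - apply is_lim_seq_const.
Qed.

(** * The operator norm *)

Definition sqmod (f : Z -> C) (k : Z) : R := (Cmod (f k))^2.

Lemma sqmod_nonneg (f : Z -> C) (k : Z) : 0 <= sqmod f k.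
Proof. apply pow2_ge_0. Qed.

Lemma sym_sum_mono (P Q : nat) (g : Z -> R) :
  (P <= Q)%nat -> (forall k, 0 <= g k) -> sym_sum P g <= sym_sum Q g.
Proof.
  intros HPQ H.
  unfold sym_sum at 1. rewrite (zsumR_ext _ _ g (fun k => if Z_le_dec (Z.abs k) (Z.of_nat P) then g k else 0)).
  - fold (sym_sum P (fun k => if Z_le_dec (Z.abs k) (Z.of_nat P) then g k else 0)).
    rewrite <- (sym_sum_widen P Q _ HPQ).
    + apply zsumR_le. intros k _. specialize (H k). destruct Z_le_dec; lra.
    + intros k Hk. destruct Z_le_dec; [lia|reflexivity].
  - intros k Hk. destruct Z_le_dec; [reflexivity|lia].
Qed.

Definition truncate (P : nat) (h : Z -> R) (k : Z) : R :=
  if Z_le_dec (Z.abs k) (Z.of_nat P) then h k else 0.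

Lemma truncate_in (P : nat) (h : Z -> R) (k : Z) :
  (Z.abs k <= Z.of_nat P)%Z -> truncate P h k = h k.
Proof. intros H. unfold truncate. destruct Z_le_dec; [reflexivity|lia]. Qed.

Lemma truncate_supported (P : nat) (h : Z -> R) : supported P (truncate P h).
Proof. intros k H. unfold truncate. destruct Z_le_dec; [lia|reflexivity]. Qed.

(** By locality the output on [{-K..K}] is that of [h] cut to radius [K + n + 4], and the finitely
    supported bound applies to the cut sequence. *)
Lemma rop_bound_window (n K : nat) (u h : Z -> R) (M : R) :
  (forall j, u j = u (- j)%Z) -> (forall xi, 0 <= symbol n u xi <= M) ->
  sym_sum K (fun k => (rop n u h k)^2) <= M^2 * sym_sum (K + n + 4) (fun k => (h k)^2).
Proof.
  intros Hu HM. set (P := (K + n + 4)%nat).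
  transitivity (sym_sum (P + n + 4) (fun k => (rop n u (truncate P h) k)^2)).
  - transitivity (sym_sum K (fun k => (rop n u (truncate P h) k)^2)).
    + apply Req_le, zsumR_ext. intros k Hk.
      rewrite (rop_local n u h (truncate P h)); [reflexivity|].
      intros j Hj. symmetry. apply truncate_in. lia.
    + apply sym_sum_mono; [lia|]. intros. apply pow2_ge_0.
  - eapply Rle_trans.
    + apply (rop_bound_finite n P _ u _ M Hu HM); [apply truncate_supported|lia].
    + apply Req_le. f_equal. apply zsumR_ext. intros k Hk. rewrite truncate_in by lia. reflexivity.
Qed.

Lemma sqmod_nabla4_conv (n K : nat) (u : Z -> R) (f : Z -> C) :
  sym_sum K (sqmod (nabla_pow 4 (conv n u f))) =
  sym_sum K (fun k => (rop n u (fun j => fst (f j)) k)^2) +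
  sym_sum K (fun k => (rop n u (fun j => snd (f j)) k)^2).
Proof.
  unfold sym_sum. rewrite <- zsumR_plus. apply zsumR_ext. intros. apply Cmod_nabla4_conv.
Qed.

Lemma l2norm_sqmod (f : Z -> C) : l2norm f = sqrt (bisum (sqmod f)).
Proof. reflexivity. Qed.

Lemma l2norm_le (n : nat) (u : Z -> R) (f : Z -> C) (M : R) :
  (forall j, u j = u (- j)%Z) -> (forall xi, 0 <= symbol n u xi <= M) -> in_l2 f ->
  l2norm (nabla_pow 4 (conv n u f)) <= M * l2norm f.
Proof.
  intros Hu HM Hf.
  (* Nonnegativity of [M] lets it move under the square root as [M^2]. *)
  assert (M0 : 0 <= M) by (destruct (HM 0); lra).
  rewrite !l2norm_sqmod, <- (sqrt_pow2 M M0), <- sqrt_mult_alt by apply pow2_ge_0.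
  apply sqrt_le_1_alt.
  apply bisum_bounded; [apply sqmod_nonneg|]. intros K.
  rewrite sqmod_nabla4_conv.
  eapply Rle_trans; [apply Rplus_le_compat; apply (rop_bound_window n K u _ M Hu HM)|].
  rewrite <- Rmult_plus_distr_l. apply Rmult_le_compat_l; [apply pow2_ge_0|].
  eapply Rle_trans; [|apply (sym_sum_le_bisum (sqmod f) (K + n + 4) (sqmod_nonneg f) Hf)].
  unfold sym_sum. rewrite <- zsumR_plus.
  apply Req_le, zsumR_ext. intros. symmetry. apply Cmod_sqr.
Qed.

Lemma bisum_pos (f : Z -> C) (k : Z) : in_l2 f -> f k <> RtoC 0 -> 0 < bisum (sqmod f).
Proof.
  intros Hf Hk.
  eapply Rlt_le_trans; [|apply (sym_sum_le_bisum (sqmod f) (Z.to_nat (Z.abs k)) (sqmod_nonneg f) Hf)].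
  apply Rlt_le_trans with (sqmod f k).
  - apply pow_lt. apply Cmod_gt_0, Hk.
  - unfold sym_sum. rewrite <- (zsumR_delta (- Z.of_nat (Z.to_nat (Z.abs k))) (2 * Z.to_nat (Z.abs k) + 1) k (sqmod f)) by lia.
    apply zsumR_le. intros j _. pose proof (sqmod_nonneg f j). destruct Z.eq_dec; lra.
Qed.

Lemma opnorm4_le (n : nat) (u : Z -> R) (M : R) :
  (forall j, u j = u (- j)%Z) -> (forall xi, 0 <= symbol n u xi <= M) ->
  Rbar_le (opnorm4 n u) M.
Proof.
  intros Hu HM. apply (proj2 (Lub_Rbar_correct _)).
  intros r (f & Hf & (k & Hk) & ->). simpl.
  assert (0 < l2norm f) by (rewrite l2norm_sqmod; apply sqrt_lt_R0, (bisum_pos f k Hf Hk)).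
  apply Rle_div_l; [assumption|]. apply l2norm_le; assumption.
Qed.

Lemma bisum_supported (P : nat) (g : Z -> R) :
  (forall k, 0 <= g k) -> supported P g -> bisummable g /\ bisum g = sym_sum P g.
Proof.
  intros Hg HP.
  assert (HB : forall K, sym_sum K g <= sym_sum P g).
  { intros K. rewrite <- (sym_sum_widen P (P + K) g) by (try assumption; lia).
    apply sym_sum_mono; [lia|assumption]. }
  destruct (bisum_bounded g _ Hg HB) as [H1 H2]. split; [assumption|].
  apply Rle_antisym; [assumption|]. apply sym_sum_le_bisum; assumption.
Qed.

(** Cosine waves are eigenfunctions of convolution with an even kernel; the phase [phi] covers sines
    as well. *)
Lemma rconv_wave (n : nat) (u : Z -> R) (xi phi : R) (k : Z) :
  (forall j, u j = u (- j)%Z) ->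
  rconv n u (fun j => cos (IZR j * xi + phi)) k = cos_sum n u xi * cos (IZR k * xi + phi).
Proof.
  intros Hu.
  transitivity (cos (IZR k * xi + phi) * cos_sum n u xi + sin (IZR k * xi + phi) * sin_sum n u xi).
  - unfold rconv, cos_sum, sin_sum, sym_sum. rewrite <- !zsumR_scal, <- zsumR_plus.
    apply zsumR_ext. intros j _.
    replace (IZR (k - j) * xi + phi) with (IZR k * xi + phi - IZR j * xi) by (rewrite minus_IZR; ring).
    rewrite cos_minus. ring.
  - rewrite sin_sum_even by assumption. ring.
Qed.

(* The wave is an eigenfunction up to a shift by two, because the fourth
   difference is centred at [k + 2]. *)
Lemma rop_wave (n : nat) (u : Z -> R) (xi phi : R) (k : Z) :
  (forall j, u j = u (- j)%Z) ->
  rop n u (fun j => cos (IZR j * xi + phi)) k = symbol n u xi * cos (IZR (k + 2) * xi + phi).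
Proof.
  intros Hu. unfold rop, rnabla. rewrite !rconv_wave by assumption.
  unfold symbol. rewrite !plus_IZR.
  set (x := (IZR k + 2) * xi + phi).
  replace ((IZR k + 1 + 1 + 1 + 1) * xi + phi) with (x + 2 * xi) by (unfold x; ring).
  replace ((IZR k + 1 + 1 + 1) * xi + phi) with (x + xi) by (unfold x; ring).
  replace ((IZR k + 1 + 1) * xi + phi) with x by (unfold x; ring).
  replace ((IZR k + 1) * xi + phi) with (x - xi) by (unfold x; ring).
  replace (IZR k * xi + phi) with (x - 2 * xi) by (unfold x; ring).
  rewrite !cos_minus, !cos_plus, cos_2a_cos, sin_2a. ring.
Qed.

(** The truncated exponential [exp(i k xi)]. Its sine is written as a cosine with phase [- PI / 2],
    so that [rop_wave] serves both components. *)
Definition wave (P : nat) (xi : R) (k : Z) : C :=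
  (truncate P (fun j => cos (IZR j * xi + 0)) k,
   truncate P (fun j => cos (IZR j * xi + - (PI / 2))) k).

Lemma sqmod_wave (P : nat) (xi : R) (k : Z) : sqmod (wave P xi) k = truncate P (fun _ => 1) k.
Proof.
  unfold sqmod. rewrite Cmod_sqr. unfold wave, truncate. simpl fst. simpl snd.
  destruct Z_le_dec; [|ring].
  rewrite <- (sin2_cos2 (IZR k * xi)), Rplus_0_r. unfold Rsqr.
  replace (IZR k * xi + - (PI / 2)) with (- (PI / 2 - IZR k * xi)) by ring.
  rewrite cos_neg, cos_shift. ring.
Qed.

Lemma bisum_wave (P : nat) (xi : R) :
  in_l2 (wave P xi) /\ bisum (sqmod (wave P xi)) = INR (2 * P + 1).
Proof.
  destruct (bisum_supported P (sqmod (wave P xi)) (sqmod_nonneg _)) as [H1 H2].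
  - intros k Hk. rewrite sqmod_wave. now apply truncate_supported.
  - split; [exact H1|]. rewrite H2. rewrite <- (Rmult_1_r (INR _)).
    unfold sym_sum. rewrite <- (zsumR_const (- Z.of_nat P)).
    apply zsumR_ext. intros k Hk. rewrite sqmod_wave. apply (truncate_in P (fun _ => 1)). lia.
Qed.

Lemma rop_supported (n P : nat) (u h : Z -> R) :
  supported P h -> supported (P + n + 4) (rop n u h).
Proof.
  intros H. replace (P + n + 4)%nat with (P + n + 1 + 1 + 1 + 1)%nat by lia.
  unfold rop. do 4 apply rnabla_supported. now apply rconv_supported.
Qed.

(** The wave extends [n + 4] beyond [P], so on [{-P..P}] the operator sees an untruncated
    exponential and the output has constant modulus. *)
Lemma bisum_op_wave (n P : nat) (u : Z -> R) (xi : R) :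
  (forall j, u j = u (- j)%Z) ->
  (symbol n u xi)^2 * INR (2 * P + 1) <=
  bisum (sqmod (nabla_pow 4 (conv n u (wave (P + n + 4) xi)))).
Proof.
  intros Hu.
  set (f := wave (P + n + 4) xi).
  assert (Hs : supported (P + n + 4 + n + 4) (sqmod (nabla_pow 4 (conv n u f)))).
  { intros k Hk. unfold sqmod. rewrite Cmod_nabla4_conv.
    rewrite !(rop_supported n (P + n + 4)); try assumption; try apply truncate_supported. ring. }
  destruct (bisum_supported _ _ (sqmod_nonneg _) Hs) as [H1 _].
  eapply Rle_trans; [|apply (sym_sum_le_bisum _ P (sqmod_nonneg _) H1)].
  rewrite Rmult_comm. unfold sym_sum. rewrite <- (zsumR_const (- Z.of_nat P)).
  apply Req_le, zsumR_ext. intros k Hk. unfold sqmod. rewrite Cmod_nabla4_conv.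
  rewrite (rop_local n u (fun j => fst (f j)) (fun j => cos (IZR j * xi + 0))).
  2:{ intros j Hj. apply truncate_in. lia. }
  rewrite (rop_local n u (fun j => snd (f j)) (fun j => cos (IZR j * xi + - (PI / 2)))).
  2:{ intros j Hj. apply truncate_in. lia. }
  rewrite !rop_wave by assumption.
  set (x := IZR (k + 2) * xi). rewrite Rplus_0_r.
  replace (x + - (PI / 2)) with (- (PI / 2 - x)) by ring. rewrite cos_neg, cos_shift.
  rewrite <- (Rmult_1_r ((symbol n u xi)^2)), <- (sin2_cos2 x). unfold Rsqr. ring.
Qed.

(** The waves give [W^2 (2P + 1) <= r^2 (2 (P + n + 4) + 1)] for every [P], and the ratio of the two
    lengths tends to 1. *)
Lemma symbol_le_opnorm4 (n : nat) (u : Z -> R) (xi : R) :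
  (forall j, u j = u (- j)%Z) -> 0 <= symbol n u xi ->
  Rbar_le (symbol n u xi) (opnorm4 n u).
Proof.
  intros Hu HW. set (W := symbol n u xi) in *.
  assert (Hub : forall P, Rbar_le
    (l2norm (nabla_pow 4 (conv n u (wave (P + n + 4) xi))) / l2norm (wave (P + n + 4) xi))
    (opnorm4 n u)).
  { intros P. apply (proj1 (Lub_Rbar_correct _)). exists (wave (P + n + 4) xi).
    destruct (bisum_wave (P + n + 4) xi) as [H1 _]. split; [exact H1|]. split; [|reflexivity].
    exists 0%Z. intros E. apply (f_equal fst) in E. simpl in E.
    rewrite truncate_in in E by lia. rewrite Rmult_0_l, Rplus_0_r, cos_0 in E. lra. }
  (* Plus infinity dominates every number, and minus infinity lies below no wave ratio. *)
  destruct (opnorm4 n u) as [r| |]; [|exact I|destruct (Hub O)].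
  simpl in Hub |- *.
  assert (Hineq : forall P, 0 <= r /\ W^2 * INR (2 * P + 1) <= r^2 * INR (2 * (P + n + 4) + 1)).
  { intros P. specialize (Hub P).
    pose proof (bisum_op_wave n P u xi Hu) as H1. fold W in H1.
    destruct (bisum_wave (P + n + 4) xi) as [_ H2].
    assert (HL : 0 < INR (2 * (P + n + 4) + 1)) by (apply lt_0_INR; lia).
    rewrite !l2norm_sqmod, H2 in Hub.
    set (A := bisum _) in *. set (L := INR (2 * (P + n + 4) + 1)) in *.
    pose proof (sqrt_lt_R0 L HL) as HsL.
    apply Rle_div_l in Hub; [|assumption].
    pose proof (sqrt_pos A) as HsA.
    assert (A0 : 0 <= A).
    { eapply Rle_trans; [|exact H1]. apply Rmult_le_pos; [apply pow2_ge_0|apply pos_INR]. }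
    split.
    - apply (Rmult_le_reg_r (sqrt L)); [assumption|]. lra.
    - eapply Rle_trans; [exact H1|].
      rewrite <- (pow2_sqrt A A0), <- (pow2_sqrt L) at 1 by lra.
      rewrite <- Rpow_mult_distr. apply pow_incr. lra. }
  destruct (Hineq O) as [Hr _].
  apply Rnot_lt_le. intros Hlt.
  assert (Hd : 0 < W^2 - r^2) by nra.
  (* [P] is so large that [(W^2 - r^2) P] exceeds the fixed boundary term [r^2 * 2 (n + 4)]. *)
  destruct (INR_unbounded (r^2 * INR (2 * (n + 4)) / (W^2 - r^2))) as [P HP].
  destruct (Hineq P) as [_ H].
  replace (2 * (P + n + 4) + 1)%nat with (2 * P + 1 + 2 * (n + 4))%nat in H by lia.
  rewrite (plus_INR (2 * P + 1)), Rmult_plus_distr_l in H.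
  apply Rgt_lt, Rlt_div_l in HP; [|assumption].
  assert (INR P <= INR (2 * P + 1)) by (apply le_INR; lia).
  nra.
Qed.

(** * Polynomial functions and divided differences *)

(** Polynomial functions of degree at most [d] in Horner form, which makes induction on the degree
    direct. *)
Fixpoint polyfun (d : nat) (f : R -> R) : Prop :=
  match d with
  | O => exists c, forall x, f x = c
  | S d' => exists c g, polyfun d' g /\ forall x, f x = c + x * g x
  end.

Lemma polyfun_ext (d : nat) (f g : R -> R) :
  (forall x, f x = g x) -> polyfun d g -> polyfun d f.
Proof.
  intros E. destruct d as [|d].
  - intros [c H]. exists c. intros x. now rewrite E.
  - intros (c & h & Hh & H). exists c, h. split; [exact Hh|]. intros x. now rewrite E.
Qed.

Lemma polyfun_const (d : nat) (c : R) : polyfun d (fun _ => c).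
Proof.
  revert c. induction d as [|d IH]; intros c.
  - now exists c.
  - exists c, (fun _ => 0). split; [apply IH|]. intros. ring.
Qed.

Lemma polyfun_S (d : nat) (f : R -> R) : polyfun d f -> polyfun (S d) f.
Proof.
  revert f. induction d as [|d IH]; intros f.
  - intros [c H]. exists c, (fun _ => 0). split; [now exists 0|]. intros. rewrite H. ring.
  - intros (c & g & Hg & H). exists c, g. split; [now apply IH|exact H].
Qed.

Lemma polyfun_weaken (d e : nat) (f : R -> R) : (d <= e)%nat -> polyfun d f -> polyfun e f.
Proof.
  intros H Hf. induction H; [exact Hf|]. now apply polyfun_S.
Qed.

Lemma polyfun_lin (d : nat) (a b : R) (f g : R -> R) :
  polyfun d f -> polyfun d g -> polyfun d (fun x => a * f x + b * g x).
Proof.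
  revert f g. induction d as [|d IH]; intros f g.
  - intros [c H] [e K]. exists (a * c + b * e). intros x. now rewrite H, K.
  - intros (c & h & Hh & H) (e & k & Hk & K).
    exists (a * c + b * e), (fun x => a * h x + b * k x).
    split; [now apply IH|]. intros x. rewrite H, K. ring.
Qed.

Lemma polyfun_mul_affine (d : nat) (a b : R) (f : R -> R) :
  polyfun d f -> polyfun (S d) (fun x => (a * x + b) * f x).
Proof.
  intros H. apply (polyfun_ext _ _ (fun x => a * (0 + x * f x) + b * f x)); [intros; ring|].
  apply polyfun_lin; [|now apply polyfun_S]. exists 0, f. split; [exact H|reflexivity].
Qed.

Lemma polyfun_zsumR (d : nat) (a : Z) (l : nat) (c : Z -> R) (f : Z -> R -> R) :
  (forall k, (a <= k < a + Z.of_nat l)%Z -> polyfun d (f k)) ->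
  polyfun d (fun x => zsumR a l (fun k => c k * f k x)).
Proof.
  induction l as [|l IH]; intros H.
  - exact (polyfun_const d 0).
  - eapply polyfun_ext; [intros x; rewrite zsumR_S, <- (Rmult_1_l (zsumR _ _ _)); reflexivity|].
    apply (polyfun_lin d 1 (c (a + Z.of_nat l)%Z)); [apply IH; intros|]; apply H; lia.
Qed.

Lemma polyfun_factor (d : nat) (f : R -> R) (a : R) :
  polyfun (S d) f -> exists g, polyfun d g /\ forall x, f x = f a + (x - a) * g x.
Proof.
  revert f. induction d as [|d IH]; intros f (c & g & Hg & H).
  - exists g. split; [exact Hg|]. destruct Hg as [e He]. intros x. rewrite !H, !He. ring.
  - destruct (IH g Hg) as (k & Hk & K).
    (* From [x g(x) - a g(a) = (x - a) g(a) + x (x - a) k(x)]. *)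
    exists (fun x => g a + x * k x). split; [exists (g a), k; now split|].
    intros x. rewrite (H x), (H a), (K x). ring.
Qed.

Lemma polyfun_continuous (d : nat) (f : R -> R) (x : R) : polyfun d f -> continuity_pt f x.
Proof.
  revert f. induction d as [|d IH]; intros f.
  - intros [c H]. apply (continuity_pt_ext (fun _ => c)); [intros; now rewrite H|].
    apply continuity_pt_const. now intros ? ?.
  - intros (c & g & Hg & H).
    apply (continuity_pt_ext (fun x => c + x * g x)); [intros; now rewrite H|].
    apply continuity_pt_plus; [apply continuity_pt_const; now intros ? ?|].
    apply continuity_pt_mult; [apply continuity_pt_id|now apply IH].
Qed.

Lemma polyfun_roots (d : nat) (f : R -> R) (t : nat -> R) :
  polyfun d f -> (forall i j, (i < j <= d)%nat -> t i <> t j) ->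
  (forall j, (j <= d)%nat -> f (t j) = 0) -> forall x, f x = 0.
Proof.
  revert f t. induction d as [|d IH]; intros f t Hf Ht H0 x.
  - destruct Hf as [c Hf]. rewrite Hf, <- (Hf (t O)). apply H0. lia.
  - destruct (polyfun_factor d f (t O) Hf) as (g & Hg & E).
    rewrite H0 in E by lia.
    rewrite E, (IH g (fun j => t (S j)) Hg); [ring|intros; apply Ht; lia|].
    intros j Hj. apply (Rmult_eq_reg_l (t (S j) - t O)).
    + rewrite Rmult_0_r, <- (H0 (S j)), E by lia. ring.
    + apply Rminus_eq_contra, not_eq_sym, Ht. lia.
Qed.

(** Supplies the cosine coefficients of the extremal polynomial, which the integral formula then
    recovers. *)
Lemma polyfun_cos_sum (d : nat) (f : R -> R) :
  polyfun d f -> exists s : Z -> R,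
    (forall j, s j = s (- j)%Z) /\ supported d s /\
    forall xi, f (cos xi) = cos_sum d s xi.
Proof.
  assert (D : forall d (c : R) xi, cos_sum d (fun k => if Z.eq_dec k 0 then c else 0) xi = c).
  { intros e c xi. unfold cos_sum, sym_sum.
    rewrite (zsumR_ext _ _ _ (fun k => if Z.eq_dec k 0 then c * cos (IZR k * xi) else 0)).
    - rewrite zsumR_delta by lia. rewrite Rmult_0_l, cos_0. ring.
    - intros k _. destruct Z.eq_dec; ring. }
  revert f. induction d as [|d IH]; intros f.
  - intros [c H]. exists (fun k => if Z.eq_dec k 0 then c else 0). repeat split.
    + intros j. destruct (Z.eq_dec j 0), (Z.eq_dec (- j) 0); try lia; reflexivity.
    + intros k Hk. destruct Z.eq_dec; [lia|reflexivity].
    + intros xi. now rewrite D.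
  - intros (c & g & Hg & H). destruct (IH g Hg) as (s & Hs & Hsup & E).
    (* Multiplication by [cos xi] averages the two unit translates of [s]; the form with [- (- / 2)]
       fits [cos_sum_minus]. *)
    exists (fun k => (if Z.eq_dec k 0 then c else 0) - (- / 2) * (s (k - 1)%Z + s (k - -1)%Z)).
    repeat split.
    + intros j. replace (- j - 1)%Z with (- (j - -1))%Z by lia.
      replace (- j - -1)%Z with (- (j - 1))%Z by lia. rewrite <- !Hs.
      destruct (Z.eq_dec j 0), (Z.eq_dec (- j) 0); try lia; ring.
    + intros k Hk. rewrite !Hsup by lia. destruct Z.eq_dec; [lia|ring].
    + intros xi. rewrite cos_sum_minus, D, H, E.
      unfold cos_sum at 1. rewrite <- (sym_sum_widen d (S d)) by (try lia; intros k Hk; rewrite Hsup by lia; ring).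
      fold (cos_sum (S d) s xi).
      transitivity (c - (- / 2) * (cos_sum (S d) (fun k => s (k - 1)%Z) xi + cos_sum (S d) (fun k => s (k - -1)%Z) xi)).
      * rewrite !(cos_sum_translate d (S d)) by (try assumption; lia).
        replace (-1 * xi) with (- (1 * xi)) by ring. rewrite cos_neg, sin_neg, Rmult_1_l. field.
      * f_equal. f_equal. unfold cos_sum, sym_sum. rewrite <- zsumR_plus, <- zsumR_scal.
        apply zsumR_ext. intros. ring.
Qed.

(** * Chebyshev polynomials *)

Lemma chebT_SS (m : nat) (x : R) : chebT (S (S m)) x = 2 * x * chebT (S m) x - chebT m x.
Proof. reflexivity. Qed.

Lemma nat_ind2 (P : nat -> Prop) :
  P O -> P 1%nat -> (forall m, P m -> P (S m) -> P (S (S m))) -> forall m, P m.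
Proof.
  intros H0 H1 HS m. enough (P m /\ P (S m)) by easy.
  induction m as [|m [IH1 IH2]]; auto.
Qed.

Lemma chebT_cos (m : nat) (xi : R) : chebT m (cos xi) = cos (INR m * xi).
Proof.
  induction m as [| |m IH0 IH1] using nat_ind2.
  - simpl. now rewrite Rmult_0_l, cos_0.
  - simpl. now rewrite Rmult_1_l.
  - rewrite chebT_SS, IH0, IH1.
    replace (INR (S (S m)) * xi) with (INR (S m) * xi + xi) by (rewrite (S_INR (S m)); ring).
    replace (INR m * xi) with (INR (S m) * xi - xi) by (rewrite (S_INR m); ring).
    rewrite cos_plus, cos_minus. ring.
Qed.

Lemma polyfun_chebT_affine (m : nat) (a b : R) : polyfun m (fun x => chebT m (a * x + b)).
Proof.
  induction m as [| |m IH0 IH1] using nat_ind2.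
  - now exists 1.
  - apply (polyfun_ext _ _ (fun x => (a * x + b) * 1)); [intros; simpl; ring|].
    apply polyfun_mul_affine. now exists 1.
  - apply (polyfun_ext _ _ (fun x => 2 * ((a * x + b) * chebT (S m) (a * x + b)) + (- (1)) * chebT m (a * x + b))).
    + intros. rewrite chebT_SS. ring.
    + apply polyfun_lin; [now apply polyfun_mul_affine|now do 2 apply polyfun_S].
Qed.

(** Each [cos (k xi)] is the Chebyshev polynomial of degree [|k|] at [cos xi]. *)
Lemma cos_sum_polyfun (n : nat) (u : Z -> R) :
  exists p, polyfun n p /\ forall xi, p (cos xi) = cos_sum n u xi.
Proof.
  exists (fun x => sym_sum n (fun k => u k * chebT (Z.abs_nat k) x)). split.
  - apply polyfun_zsumR. intros k Hk. apply (polyfun_weaken (Z.abs_nat k)); [lia|].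
    apply (polyfun_ext _ _ (fun x => chebT (Z.abs_nat k) (1 * x + 0))).
    + intros x. now rewrite Rmult_1_l, Rplus_0_r.
    + apply polyfun_chebT_affine.
  - intros xi. apply zsumR_ext. intros k _. rewrite chebT_cos. f_equal.
    rewrite INR_IZR_INZ, Zabs2Nat.id_abs. destruct (Z.abs_eq_or_opp k) as [->| ->]; [reflexivity|].
    rewrite opp_IZR, <- Ropp_mult_distr_l, cos_neg. reflexivity.
Qed.

(* Uses the [m + 1] nodes [t i], ..., [t (i + m)]. *)
Fixpoint divdiff (f : R -> R) (t : nat -> R) (i m : nat) : R :=
  match m with
  | O => f (t i)
  | S m' => (divdiff f t (S i) m' - divdiff f t i m') / (t (i + S m')%nat - t i)
  end.

(** The two lower divided differences have opposite weak signs and the denominator is negative, so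
    nothing cancels. The sign [s] is general because the block starting at [S i] begins with the
    opposite one. *)
Lemma divdiff_alternating (f : R -> R) (t : nat -> R) (m i : nat) (s : R) :
  (forall j k, (i <= j < k)%nat -> (k <= i + m)%nat -> t k < t j) ->
  (forall j, (j <= m)%nat -> 0 <= s * (-1)^j * f (t (i + j)%nat)) ->
  0 <= s * divdiff f t i m /\
  (s <> 0 -> divdiff f t i m = 0 -> forall j, (j <= m)%nat -> f (t (i + j)%nat) = 0).
Proof.
  revert i s. induction m as [|m IH]; intros i s Ht H.
  - split.
    + specialize (H O (le_n _)). rewrite Nat.add_0_r, pow_O, Rmult_1_r in H. exact H.
    + intros _ H0 j Hj. replace (i + j)%nat with i by lia. exact H0.
  - destruct (IH i s) as [P1 Q1]; [intros; apply Ht; lia|intros; apply H; lia|].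
    destruct (IH (S i) (- s)) as [P2 Q2]; [intros; apply Ht; lia| |].
    { intros j Hj. specialize (H (S j) ltac:(lia)).
      replace (S i + j)%nat with (i + S j)%nat by lia.
      replace (- s * (-1)^j) with (s * (-1)^(S j)) by (simpl; ring). exact H. }
    assert (Hd : t (i + S m)%nat - t i < 0) by (apply Rlt_minus, Ht; lia).
    simpl divdiff. set (A := divdiff f t i m) in *. set (B := divdiff f t (S i) m) in *.
    set (D := t (i + S m)%nat - t i) in *. split.
    + replace (s * ((B - A) / D)) with ((- s * B + s * A) * / - D) by (field; lra).
      apply Rmult_le_pos; [lra|]. apply Rlt_le, Rinv_0_lt_compat. lra.
    + intros Hs H0.
      assert (HBA : B = A).
      { apply (Rmult_eq_compat_r D) in H0. unfold Rdiv in H0.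
        rewrite Rmult_assoc, Rinv_l in H0 by lra. lra. }
      assert (HA : A = 0).
      { apply (Rmult_eq_reg_l s); [|exact Hs]. rewrite HBA in P2. lra. }
      intros j Hj. destruct j as [|j].
      * apply Q1; [exact Hs|exact HA|lia].
      * replace (i + S j)%nat with (S i + j)%nat by lia. apply Q2; [lra|congruence|lia].
Qed.

(** The Leibniz rule for a product with the identity; the constant disappears since the order is
    positive. *)
Lemma divdiff_leibniz (f g : R -> R) (t : nat -> R) (c : R) (m i : nat) :
  (forall j k, (i <= j < k)%nat -> (k <= i + S m)%nat -> t k <> t j) ->
  (forall x, f x = c + x * g x) ->
  divdiff f t i (S m) = t (i + S m)%nat * divdiff g t i (S m) + divdiff g t i m.
Proof.
  intros Ht Hf. revert i Ht. induction m as [|m IH]; intros i Ht.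
  - simpl. rewrite !Hf. replace (i + 1)%nat with (S i) by lia. field.
    apply Rminus_eq_contra, Ht; lia.
  - change (divdiff f t i (S (S m))) with
      ((divdiff f t (S i) (S m) - divdiff f t i (S m)) / (t (i + S (S m))%nat - t i)).
    rewrite !IH by (intros; apply Ht; lia).
    replace (S i + S m)%nat with (i + S (S m))%nat by lia.
    change (divdiff g t i (S (S m))) with
      ((divdiff g t (S i) (S m) - divdiff g t i (S m)) / (t (i + S (S m))%nat - t i)).
    assert (E : divdiff g t (S i) m = divdiff g t i m + (t (i + S m)%nat - t i) * divdiff g t i (S m)).
    { simpl. field. apply Rminus_eq_contra, Ht; lia. }
    rewrite E. field. apply Rminus_eq_contra, Ht; lia.
Qed.

(** Each Horner step lowers the degree by one and, through the Leibniz rule, the order by at most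
    one. *)
Lemma divdiff_polyfun (d m i : nat) (f : R -> R) (t : nat -> R) :
  polyfun d f -> (d < m)%nat ->
  (forall j k, (i <= j < k)%nat -> (k <= i + m)%nat -> t k <> t j) ->
  divdiff f t i m = 0.
Proof.
  revert m f. induction d as [|d IH]; intros m f Hf Hm Ht.
  - destruct Hf as [c Hf]. destruct m as [|m]; [lia|]. clear Hm. revert i Ht.
    induction m as [|m IHm]; intros i Ht.
    + simpl. rewrite !Hf. unfold Rdiv. ring.
    + change (divdiff f t i (S (S m))) with
        ((divdiff f t (S i) (S m) - divdiff f t i (S m)) / (t (i + S (S m))%nat - t i)).
      rewrite !IHm by (intros; apply Ht; lia). unfold Rdiv. ring.
  - destruct Hf as (c & g & Hg & Hf). destruct m as [|m]; [lia|].
    rewrite (divdiff_leibniz f g t c) by assumption.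
    rewrite !(IH _ g Hg) by (try lia; intros; apply Ht; lia). ring.
Qed.

(* The divided difference over [d + 2] nodes vanishes, yet all its terms have
   the same sign; so [f] vanishes at every node. *)
Lemma polyfun_alternating_zero (d : nat) (f : R -> R) (t : nat -> R) :
  polyfun d f ->
  (forall j k, (j < k <= S d)%nat -> t k < t j) ->
  (forall j, (j <= S d)%nat -> 0 <= (-1)^j * f (t j)) ->
  forall x, f x = 0.
Proof.
  intros Hf Ht H.
  destruct (divdiff_alternating f t (S d) 0 1) as [_ Q].
  - intros; apply Ht; lia.
  - intros j Hj. rewrite Rmult_1_l. now apply H.
  - apply (polyfun_roots d f t Hf).
    + intros i j Hij. apply Rgt_not_eq, Ht. lia.
    + intros j Hj. apply (Q R1_neq_R0); [|lia].
      apply (divdiff_polyfun d); [exact Hf|lia|]. intros. apply Rlt_not_eq, Ht. lia.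
Qed.

(** * The extremal polynomial *)

(* [sin (m t) / sin t], extended continuously by [m] at [t = 0]. *)
Fixpoint sin_ratio (m : nat) (t : R) : R :=
  match m with
  | O => 0
  | S m' => sin_ratio m' t * cos t + cos (INR m' * t)
  end.

Lemma sin_ratio_mult (m : nat) (t : R) : sin_ratio m t * sin t = sin (INR m * t).
Proof.
  induction m as [|m IH].
  - simpl. now rewrite !Rmult_0_l, sin_0.
  - rewrite S_INR, Rmult_plus_distr_r, Rmult_1_l, sin_plus, <- IH. simpl. ring.
Qed.

Lemma sin_ratio_0 (m : nat) : sin_ratio m 0 = INR m.
Proof.
  induction m as [|m IH]; [reflexivity|].
  rewrite S_INR. simpl. rewrite IH, Rmult_0_r, cos_0. ring.
Qed.

Lemma continuity_pt_cos_affine (a b t : R) : continuity_pt (fun t => cos (a + b * t)) t.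
Proof.
  apply derivable_continuous_pt. reg.
Qed.

Lemma continuity_pt_sin_affine (a b t : R) : continuity_pt (fun t => sin (a + b * t)) t.
Proof.
  apply derivable_continuous_pt. reg.
Qed.

Lemma sin_ratio_continuous (m : nat) (t : R) : continuity_pt (sin_ratio m) t.
Proof.
  induction m as [|m IH].
  - apply continuity_pt_const. now intros ? ?.
  - simpl. apply continuity_pt_plus.
    + apply continuity_pt_mult; [exact IH|apply continuity_cos].
    + apply (continuity_pt_ext (fun t => cos (0 + INR m * t))).
      * intros. now rewrite Rplus_0_l.
      * apply continuity_pt_cos_affine.
Qed.

(** The factor may be cancelled at small positive [t], where the sine is positive; continuity
    carries the equality to 0. *)
Lemma continuity_cancel_sin (f g : R -> R) :
  continuity_pt f 0 -> continuity_pt g 0 ->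
  (forall t, f t * sin t = g t * sin t) -> f 0 = g 0.
Proof.
  intros Hf Hg H.
  destruct (Req_dec (f 0) (g 0)) as [E|E]; [exact E|exfalso].
  pose proof (continuity_pt_minus _ _ _ Hf Hg) as Hc.
  assert (He : Rabs (f 0 - g 0) > 0) by (apply Rabs_pos_lt; lra).
  destruct (Hc _ He) as (d & Hd & Hlim).
  set (t := Rmin (d / 2) 1).
  assert (Ht : 0 < t <= 1 /\ t < d).
  { unfold t. split; [split|].
    - apply Rmin_glb_lt; lra.
    - apply Rmin_r.
    - eapply Rle_lt_trans; [apply Rmin_l|lra]. }
  assert (Hst : 0 < sin t) by (apply sin_gt_0; pose proof PI_4; pose proof PI2_1; lra).
  assert (Ht0 : f t = g t) by (apply (Rmult_eq_reg_r (sin t)); [apply H|lra]).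
  assert (Hb : Rabs ((f t - g t) - (f 0 - g 0)) < Rabs (f 0 - g 0)).
  { apply (Hlim t). split.
    - split; [exact I|lra].
    - simpl. unfold Rdist. rewrite Rabs_pos_eq; lra. }
  rewrite Ht0, Rminus_diag, Rminus_0_l, Rabs_Ropp in Hb. lra.
Qed.

Section Extremal.

Variable n : nat.

(** The map [x -> slope * (x + 1) - 1] fixes -1 and sends 1 to [cos (PI / (n + 2))], the largest
    zero of [1 + T_(n+2)]. *)
Definition slope : R := (1 + cos (PI / (INR n + 2))) / 2.
(** The weighted extremal polynomial [(1 - x)^2 S_n(x)] oscillates between 0 and [2 * level], so the
    bound of the theorem is [8 * level]. *)
Definition level : R := 8 / (INR n + 2)^2 * (tan (PI / (2 * INR n + 4)))^2.

Lemma n2_pos : 0 < INR n + 2.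
Proof. pose proof (pos_INR n). lra. Qed.

Lemma half_angle : PI / (INR n + 2) = 2 * (PI / (2 * INR n + 4)).
Proof. pose proof n2_pos. field. split; lra. Qed.

Lemma half_angle_bounds : 0 < PI / (2 * INR n + 4) <= PI / 4.
Proof.
  pose proof (pos_INR n). pose proof PI_RGT_0. split.
  - apply Rdiv_lt_0_compat; lra.
  - apply Rmult_le_compat_l; [lra|]. apply Rinv_le_contravar; lra.
Qed.

Lemma slope_half : slope = (cos (PI / (2 * INR n + 4)))^2.
Proof.
  unfold slope. rewrite half_angle, cos_2a_cos. field.
Qed.

Lemma cos_half_pos : 0 < cos (PI / (2 * INR n + 4)).
Proof.
  destruct half_angle_bounds. pose proof PI_RGT_0. apply cos_gt_0; lra.
Qed.

Lemma sin_half_pos : 0 < sin (PI / (2 * INR n + 4)).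
Proof.
  destruct half_angle_bounds. pose proof PI_RGT_0. apply sin_gt_0; lra.
Qed.

Lemma slope_pos : 0 < slope.
Proof.
  rewrite slope_half. apply pow_lt, cos_half_pos.
Qed.

Lemma level_pos : 0 < level.
Proof.
  unfold level. pose proof n2_pos.
  apply Rmult_lt_0_compat.
  - apply Rdiv_lt_0_compat; [lra|]. now apply pow_lt.
  - apply pow_lt. unfold tan. apply Rdiv_lt_0_compat; [apply sin_half_pos|apply cos_half_pos].
Qed.

Definition bump (x : R) : R := 1 + chebT (n + 2) (slope * (x + 1) - 1).

Lemma bump_cos (theta : R) :
  bump ((cos theta + 1) / slope - 1) = 1 + cos ((INR n + 2) * theta).
Proof.
  unfold bump. pose proof slope_pos.
  replace (slope * ((cos theta + 1) / slope - 1 + 1) - 1) with (cos theta) by (field; lra).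
  rewrite chebT_cos, plus_INR. reflexivity.
Qed.

Lemma bump_polyfun : polyfun (n + 2) bump.
Proof.
  apply (polyfun_ext _ _ (fun x => 1 * 1 + 1 * chebT (n + 2) (slope * x + (slope - 1)))).
  - intros x. unfold bump. rewrite !Rmult_1_l. do 2 f_equal. ring.
  - apply (polyfun_lin _ 1 1 (fun _ => 1)); [apply polyfun_const|apply polyfun_chebT_affine].
Qed.

Lemma bump_bounds (x : R) : -1 <= x <= 1 -> 0 <= bump x <= 2.
Proof.
  intros Hx. pose proof slope_pos as Ha.
  assert (Ha1 : slope <= 1).
  { unfold slope. pose proof (COS_bound (PI / (INR n + 2))). lra. }
  set (y := slope * (x + 1) - 1).
  assert (Hy : -1 <= y <= 1) by (unfold y; split; nra).
  unfold bump. fold y. rewrite <- (cos_acos y Hy), chebT_cos.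
  pose proof (COS_bound (INR (n + 2) * acos y)). lra.
Qed.

(* [bump] has a double zero at 1; dividing twice by [x - 1] leaves a
   polynomial whose value at 1 is found by letting [t] tend to 0 along
   [slope * (x + 1) - 1 = cos (PI / (n + 2) + 2 t)]. *)
Lemma Sn_polyfun :
  exists p, polyfun n p /\ p 1 = 1 /\
    (forall x, x <> 1 -> Sn n x = p x) /\
    (forall x, (1 - x)^2 * p x = level * bump x).
Proof.
  pose proof n2_pos as Hn. pose proof slope_pos as Ha.
  set (b := PI / (INR n + 2)).
  set (X := fun t => (cos (b + 2 * t) + 1) / slope - 1).
  assert (Hab : slope * 2 = 1 + cos b) by (unfold slope; fold b; field).
  assert (X0 : X 0 = 1).
  { unfold X. rewrite Rmult_0_r, Rplus_0_r. replace (cos b + 1) with (slope * 2) by lra. field. lra. }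
  assert (HX : forall t, slope * (X t - 1) = - 2 * sin (b + t) * sin t).
  { intros t. transitivity (cos ((b + t) + t) - cos ((b + t) - t)).
    - replace (b + t + t) with (b + 2 * t) by ring. replace (b + t - t) with b by ring.
      replace (cos b) with (slope * 2 - 1) by lra. unfold X. field. lra.
    - rewrite cos_plus, cos_minus. ring. }
  (* The angle [(n + 2) b] equals [PI], so [bump] becomes [1 - cos (2 (n + 2) t) = 2 sin^2 ((n + 2)
     t)]. *)
  assert (HG : forall t, bump (X t) = 2 * (sin_ratio (n + 2) t)^2 * (sin t)^2).
  { intros t. unfold X. rewrite bump_cos.
    replace ((INR n + 2) * (b + 2 * t)) with (2 * (INR (n + 2) * t) + PI)
      by (rewrite plus_INR; unfold b; simpl; field; lra).
    rewrite neg_cos, cos_2a_sin, <- sin_ratio_mult. ring. }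
  assert (HXc : continuity_pt X 0).
  { unfold X. apply (continuity_pt_ext (fun t => / slope * (cos (b + 2 * t) + 1) + - (1))).
    - intros t. field. lra.
    - apply continuity_pt_plus; [|apply continuity_pt_const; now intros ? ?].
      apply continuity_pt_mult; [apply continuity_pt_const; now intros ? ?|].
      apply continuity_pt_plus; [|apply continuity_pt_const; now intros ? ?].
      apply continuity_pt_cos_affine. }
  assert (Hc : forall d g, polyfun d g -> continuity_pt (fun t => g (X t)) 0).
  { intros d g Hg. apply (continuity_pt_comp X g); [exact HXc|now apply (polyfun_continuous d)]. }
  assert (Hsc : continuity_pt (fun t => sin (b + t)) 0).
  { apply (continuity_pt_ext (fun t => sin (b + 1 * t))); [intros; now rewrite Rmult_1_l|].
    apply continuity_pt_sin_affine. }
  assert (Hrc : continuity_pt (fun t => slope * (sin_ratio (n + 2) t)^2) 0).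
  { apply continuity_pt_mult; [apply continuity_pt_const; now intros ? ?|].
    apply (continuity_pt_ext (fun t => sin_ratio (n + 2) t * sin_ratio (n + 2) t)); [intros; ring|].
    apply continuity_pt_mult; apply sin_ratio_continuous. }
  assert (Hsb : 0 < sin b).
  { unfold b. rewrite half_angle, sin_2a. pose proof sin_half_pos. pose proof cos_half_pos. nra. }
  pose proof bump_polyfun as HP. replace (n + 2)%nat with (S (S n)) in HP by lia.
  destruct (polyfun_factor _ _ 1 HP) as (g1 & Hg1 & E1).
  assert (B1 : bump 1 = 0) by (rewrite <- X0, HG, sin_0; ring).
  assert (C1 : forall t, slope * (sin_ratio (n + 2) t)^2 * sin t * sin t =
                         - sin (b + t) * g1 (X t) * sin t).
  { intros t. apply (Rmult_eq_reg_l 2); [|lra].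
    transitivity (slope * bump (X t)); [rewrite HG; ring|].
    rewrite E1, B1, Rplus_0_l, <- Rmult_assoc, HX. ring. }
  (* After one [sin t] is cancelled, the left side still vanishes at [t = 0], while [sin b > 0];
     hence 1 is a double zero. *)
  assert (G1 : g1 1 = 0).
  { assert (E : slope * (sin_ratio (n + 2) 0)^2 * sin 0 = - sin (b + 0) * g1 (X 0)).
    { apply (continuity_cancel_sin (fun t => slope * (sin_ratio (n + 2) t)^2 * sin t)
               (fun t => - sin (b + t) * g1 (X t))).
      - apply continuity_pt_mult; [exact Hrc|apply continuity_sin].
      - apply continuity_pt_mult; [now apply continuity_pt_opp|now apply (Hc (S n))].
      - exact C1. }
    rewrite X0, sin_0, Rplus_0_r in E. apply (Rmult_eq_reg_l (- sin b)); lra. }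
  destruct (polyfun_factor _ _ 1 Hg1) as (g2 & Hg2 & E2).
  assert (C2 : forall t, slope * (slope * (sin_ratio (n + 2) t)^2) * sin t * sin t =
                         2 * (sin (b + t))^2 * g2 (X t) * sin t * sin t).
  { intros t. transitivity (slope * (slope * (sin_ratio (n + 2) t)^2 * sin t * sin t)); [ring|].
    rewrite C1, E2, G1, Rplus_0_l.
    transitivity (- sin (b + t) * (slope * (X t - 1)) * g2 (X t) * sin t); [ring|].
    rewrite HX. ring. }
  assert (G2 : slope^2 * (INR n + 2)^2 = 2 * (sin b)^2 * g2 1).
  { assert (E : slope * (slope * (sin_ratio (n + 2) 0)^2) = 2 * (sin (b + 0))^2 * g2 (X 0)).
    { assert (D1 : continuity_pt (fun t => slope * (slope * (sin_ratio (n + 2) t)^2)) 0)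
        by (apply continuity_pt_mult; [apply continuity_pt_const; now intros ? ?|exact Hrc]).
      assert (D2 : continuity_pt (fun t => 2 * (sin (b + t))^2 * g2 (X t)) 0).
      { apply continuity_pt_mult; [|now apply (Hc n)].
        apply continuity_pt_mult; [apply continuity_pt_const; now intros ? ?|].
        apply (continuity_pt_ext (fun t => sin (b + t) * sin (b + t))); [intros; ring|].
        now apply continuity_pt_mult. }
      apply (continuity_cancel_sin (fun t => slope * (slope * (sin_ratio (n + 2) t)^2))
               (fun t => 2 * (sin (b + t))^2 * g2 (X t)) D1 D2).
      (* Of the two sine factors in [C2], one is cancelled pointwise here and the other by
         continuity. *)
      intros t. destruct (Req_dec (sin t) 0) as [->|Hs]; [ring|].
      apply (Rmult_eq_reg_r (sin t)); [apply C2|exact Hs]. }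
    rewrite X0, Rplus_0_r, sin_ratio_0, plus_INR in E. simpl (INR 2) in E.
    replace (1 + 1) with 2 in E by ring. rewrite <- E. ring. }
  assert (HE : forall x, (1 - x)^2 * (level * g2 x) = level * bump x).
  { intros x. rewrite E1, B1, E2, G1. ring. }
  exists (fun x => level * g2 x). repeat split.
  - apply (polyfun_ext _ _ (fun x => level * g2 x + 0 * g2 x)); [intros; ring|].
    now apply polyfun_lin.
  - assert (Hcos := cos_half_pos). assert (Hsin := sin_half_pos).
    unfold b in G2, Hsb. rewrite half_angle, sin_2a in G2, Hsb. rewrite slope_half in G2.
    unfold level, tan.
    set (c := cos (PI / (2 * INR n + 4))) in *. set (s := sin (PI / (2 * INR n + 4))) in *.
    (* With [sin b = 2 s c] and [slope = c^2], [G2] reads [c^4 (n + 2)^2 = 8 s^2 c^2 g2(1)], that is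
       [g2(1) = 1 / level]. *)
    apply (Rmult_eq_reg_l (2 * (2 * s * c)^2)).
    + transitivity (8 / (INR n + 2)^2 * (s / c)^2 * (2 * (2 * s * c)^2 * g2 1)); [ring|].
      rewrite <- G2. field. lra.
    + apply Rgt_not_eq. apply Rmult_lt_0_compat; [lra|]. now apply pow_lt.
  - intros x Hx. apply (Rmult_eq_reg_l ((1 - x)^2)).
    + rewrite HE. unfold Sn, bump. fold level slope. field. lra.
    + apply pow_nonzero. lra.
  - exact HE.
Qed.

(** * Equioscillation nodes and uniqueness of the extremal polynomial *)

Definition node (i : nat) : R := (cos (INR (S i) * (PI / (INR n + 2))) + 1) / slope - 1.

Lemma node_0 : node 0 = 1.
Proof.
  unfold node. pose proof slope_pos. simpl INR. rewrite Rmult_1_l.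
  replace (cos (PI / (INR n + 2)) + 1) with (2 * slope) by (unfold slope; field). field. lra.
Qed.

Lemma node_angle_bounds (i : nat) : (i <= S n)%nat -> 0 < INR (S i) * (PI / (INR n + 2)) <= PI.
Proof.
  intros Hi. pose proof n2_pos. pose proof PI_RGT_0.
  assert (0 < PI / (INR n + 2)) by (apply Rdiv_lt_0_compat; lra).
  split.
  - apply Rmult_lt_0_compat; [apply lt_0_INR; lia|assumption].
  - replace PI with ((INR n + 2) * (PI / (INR n + 2))) at 2 by (field; lra).
    apply Rmult_le_compat_r; [lra|].
    replace (INR n + 2) with (INR (S (S n))) by (rewrite !S_INR; ring). apply le_INR. lia.
Qed.

Lemma node_decreasing (j k : nat) : (j < k <= S n)%nat -> node k < node j.
Proof.
  intros Hjk. pose proof slope_pos. pose proof n2_pos. pose proof PI_RGT_0.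
  destruct (node_angle_bounds j) as [A1 A2]; [lia|].
  destruct (node_angle_bounds k) as [B1 B2]; [lia|].
  unfold node. apply Rplus_lt_compat_r, Rmult_lt_compat_r; [now apply Rinv_0_lt_compat|].
  apply Rplus_lt_compat_r. apply cos_decreasing_1; try lra.
  apply Rmult_lt_compat_r; [apply Rdiv_lt_0_compat; lra|]. apply lt_INR. lia.
Qed.

Lemma node_bounds (i : nat) : (i <= S n)%nat -> -1 <= node i <= 1.
Proof.
  intros Hi. split.
  - unfold node. pose proof (COS_bound (INR (S i) * (PI / (INR n + 2)))).
    assert (0 <= (cos (INR (S i) * (PI / (INR n + 2))) + 1) / slope); [|lra].
    apply Rmult_le_pos; [lra|]. apply Rlt_le, Rinv_0_lt_compat, slope_pos.
  - destruct i as [|i]; [rewrite node_0; lra|]. rewrite <- node_0. apply Rlt_le, node_decreasing. lia.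
Qed.

(** The angle is [(i + 1) PI] after multiplication by [n + 2], so zeros (even [i]) and maxima (odd
    [i]) alternate. *)
Lemma bump_node (i : nat) : bump (node i) = 1 - (-1)^i.
Proof.
  unfold node. rewrite bump_cos. pose proof n2_pos.
  replace ((INR n + 2) * (INR (S i) * (PI / (INR n + 2)))) with (INR (S i) * PI) by (field; lra).
  assert (E : forall m, cos (INR m * PI) = (-1)^m).
  { induction m as [|m IH]; [simpl; now rewrite Rmult_0_l, cos_0|].
    rewrite S_INR, Rmult_plus_distr_r, Rmult_1_l, neg_cos, IH. simpl. ring. }
  rewrite E. simpl. ring.
Qed.

(** At even nodes other than 1 [q] vanishes and [p >= q]; at odd nodes the weighted [q] is maximal
    and [p <= q]; at the node 1 both equal 1. These are [n + 2] weak alternations for degree [n]. *)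
Lemma extremal_unique (p q : R -> R) :
  polyfun n p -> polyfun n q -> p 1 = 1 -> q 1 = 1 ->
  (forall x, (1 - x)^2 * q x = level * bump x) ->
  (forall x, -1 <= x <= 1 -> 0 <= p x /\ (1 - x)^2 * p x <= 2 * level) ->
  forall x, p x = q x.
Proof.
  intros Hp Hq P1 Q1 HQ HP x.
  cut (1 * p x + (-1) * q x = 0); [lra|]. revert x.
  apply (polyfun_alternating_zero n _ node).
  - now apply polyfun_lin.
  - apply node_decreasing.
  - intros j Hj. destruct j as [|j].
    + rewrite node_0, P1, Q1. simpl. lra.
    + destruct (HP (node (S j)) (node_bounds _ Hj)) as [HP1 HP2].
      specialize (HQ (node (S j))). rewrite bump_node in HQ.
      assert (Hlt : node (S j) < 1) by (rewrite <- node_0; apply node_decreasing; lia).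
      set (y := node (S j)) in *.
      assert (Hy : 0 < (1 - y)^2) by (apply pow_lt; lra).
      apply (Rmult_le_reg_l ((1 - y)^2)); [exact Hy|]. rewrite Rmult_0_r.
      replace ((1 - y)^2 * ((-1)^(S j) * (1 * p y + -1 * q y))) with
        ((-1)^(S j) * ((1 - y)^2 * p y - (1 - y)^2 * q y)) by ring.
      rewrite HQ.
      pose proof level_pos.
      assert (0 <= (1 - y)^2 * p y) by (apply Rmult_le_pos; lra).
      destruct (Nat.Even_or_Odd (S j)) as [[i Hi]|[i Hi]]; rewrite Hi.
      * rewrite pow_1_even. lra.
      * rewrite Nat.add_1_r, pow_1_odd. lra.
Qed.

End Extremal.

(** * The integral formula for the coefficients *)

(** Monotonicity of the cosine replaces the derivative, which blows up at the endpoint: [x > cos e]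
    forces [acos x < e]. *)
Lemma acos_at_left_1 : filterlim acos (at_left 1) (locally 0).
Proof.
  apply filterlim_locally. intros eps.
  set (e := Rmin eps 1).
  assert (He : 0 < e <= 1 /\ e <= eps).
  { unfold e. destruct eps as [eps He]. simpl. repeat split.
    - apply Rmin_glb_lt; lra.
    - apply Rmin_r.
    - apply Rmin_l. }
  pose proof PI2_1 as HPI.
  assert (Hc : 0 < 1 - cos e).
  { assert (cos e < cos 0) by (apply cos_decreasing_1; lra). rewrite cos_0 in *. lra. }
  assert (Hc1 : 0 <= cos e) by (apply cos_ge_0; lra).
  exists (mkposreal _ Hc). intros x Hx Hx1.
  unfold ball in Hx. simpl in Hx. unfold AbsRing_ball, abs, minus, plus, opp in Hx. simpl in Hx.
  apply Rabs_lt_between in Hx.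
  unfold ball. simpl. unfold AbsRing_ball, abs, minus, plus, opp. simpl.
  rewrite Ropp_0, Rplus_0_r.
  pose proof (acos_bound x). rewrite Rabs_pos_eq by lra.
  apply Rlt_le_trans with e; [|lra]. apply Rnot_le_lt. intros Hle.
  assert (cos (acos x) <= cos e) by (apply cos_decr_1; lra).
  rewrite cos_acos in * by lra. lra.
Qed.

Lemma acos_at_right_m1 : filterlim acos (at_right (-1)) (locally PI).
Proof.
  apply (filterlim_ext (fun x => PI - acos (- x))).
  - intros x. rewrite acos_opp. ring.
  - apply (filterlim_comp _ _ _ (fun x => acos (- x)) (fun y => PI - y) _ (locally 0)).
    + apply (filterlim_comp _ _ _ Ropp acos _ (at_left 1)).
      * pose proof (filterlim_Ropp_right (-1)) as H. replace (- -1) with 1 in H by ring. exact H.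
      * apply acos_at_left_1.
    + assert (C : continuous (fun y : R => PI - y) 0).
      { apply (continuous_minus (fun _ => PI) (fun y => y)); [apply continuous_const|apply continuous_id]. }
      unfold continuous in C. rewrite Rminus_0_r in C. exact C.
Qed.

Lemma is_derive_acos (x : R) : -1 < x < 1 -> is_derive acos x (- / sqrt (1 - x^2)).
Proof.
  intros Hx. apply is_derive_Reals.
  replace (- / sqrt (1 - x^2)) with (derive_pt acos x (derivable_pt_acos x Hx)).
  - apply derive_pt_eq_1 with (derivable_pt_acos x Hx). reflexivity.
  - rewrite derive_pt_acos. replace (1 - x²) with (1 - x^2) by (unfold Rsqr; ring).
    unfold Rdiv. ring.
Qed.

(** Allows the integrand of the improper integral to be treated on the open interval only, away from
    the endpoint singularities. *)
Lemma segments_in_open_interval :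
  filter_prod (at_right (-1)) (at_left 1) (fun ab : R * R =>
    forall x, Rmin (fst ab) (snd ab) <= x <= Rmax (fst ab) (snd ab) -> -1 < x < 1).
Proof.
  apply (Filter_prod _ _ _ (fun y => -1 < y < 1) (fun y => -1 < y < 1)).
  - exists (mkposreal 1 Rlt_0_1). intros y Hy Hy1.
    unfold ball in Hy. simpl in Hy. unfold AbsRing_ball, abs, minus, plus, opp in Hy. simpl in Hy.
    apply Rabs_lt_between in Hy. lra.
  - exists (mkposreal 1 Rlt_0_1). intros y Hy Hy1.
    unfold ball in Hy. simpl in Hy. unfold AbsRing_ball, abs, minus, plus, opp in Hy. simpl in Hy.
    apply Rabs_lt_between in Hy. lra.
  - intros a b Ha Hb x [Hx1 Hx2]. simpl in Hx1, Hx2. split.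
    + eapply Rlt_le_trans; [|exact Hx1]. apply Rmin_glb_lt; lra.
    + eapply Rle_lt_trans; [exact Hx2|]. apply Rmax_lub_lt; lra.
Qed.

(** The substitution [t = acos x]: the function [- H (acos x)] is a primitive on the open interval
    and has limits at both ends. *)
Lemma is_RInt_gen_acos (h H : R -> R) :
  (forall t, is_derive H t (h t)) -> (forall t, continuous h t) ->
  is_RInt_gen (fun x => h (acos x) / sqrt (1 - x^2)) (at_right (-1)) (at_left 1) (H PI - H 0).
Proof.
  intros HH Hh.
  set (k := fun x => h (acos x) / sqrt (1 - x^2)).
  set (F := fun x => - H (acos x)).
  assert (HF : forall x, -1 < x < 1 -> is_derive F x (k x)).
  { intros x Hx. unfold F, k.
    replace (h (acos x) / sqrt (1 - x^2)) with (- (- / sqrt (1 - x^2) * h (acos x)))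
      by (unfold Rdiv; ring).
    apply (is_derive_opp (fun x => H (acos x)) x (- / sqrt (1 - x^2) * h (acos x))).
    apply (is_derive_comp H acos); [apply HH|now apply is_derive_acos]. }
  assert (Hk : forall x, -1 < x < 1 -> continuous k x).
  { intros x Hx. unfold k, Rdiv.
    assert (Hp : 0 < 1 - x^2) by nra.
    apply (continuous_mult (fun x => h (acos x)) (fun x => / sqrt (1 - x^2))).
    - apply (continuous_comp acos h); [|apply Hh].
      apply (ex_derive_continuous acos). eexists. now apply is_derive_acos.
    - apply (ex_derive_continuous (fun x => / sqrt (1 - x^2))). auto_derive. repeat split.
      + lra.
      + apply Rgt_not_eq, sqrt_lt_R0. simpl in Hp |- *. lra. }
  assert (Hloc : forall x, -1 < x < 1 -> locally x (fun y => -1 < y < 1)).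
  { intros x Hx. apply (open_and (fun y => -1 < y) (fun y => y < 1)); [apply open_gt|apply open_lt|exact Hx]. }
  pose proof segments_in_open_interval as HFl.
  replace (H PI - H 0) with (- H 0 - - H PI) by ring.
  apply (is_RInt_gen_ext (Derive F)).
  { revert HFl. apply filter_imp. intros ab Hab x Hx. apply is_derive_unique, HF, Hab. lra. }
  apply is_RInt_gen_Derive.
  - revert HFl. apply filter_imp. intros ab Hab x Hx. eexists. apply HF, Hab, Hx.
  - revert HFl. apply filter_imp. intros ab Hab x Hx. apply (continuous_ext_loc _ k).
    + generalize (Hloc x (Hab x Hx)). apply filter_imp. intros y Hy.
      symmetry. apply is_derive_unique, HF, Hy.
    + apply Hk, Hab, Hx.
  - apply (filterlim_comp _ _ _ acos (fun y => - H y) _ (locally PI)); [apply acos_at_right_m1|].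
    apply (continuous_opp H). apply (ex_derive_continuous H). eexists. apply HH.
  - apply (filterlim_comp _ _ _ acos (fun y => - H y) _ (locally 0)); [apply acos_at_left_1|].
    apply (continuous_opp H). apply (ex_derive_continuous H). eexists. apply HH.
Qed.

Lemma is_derive_zsumR (a : Z) (l : nat) (G : Z -> R -> R) (g : Z -> R) (t : R) :
  (forall k, is_derive (G k) t (g k)) ->
  is_derive (fun t => zsumR a l (fun k => G k t)) t (zsumR a l g).
Proof.
  intros H. induction l as [|l IH].
  - apply (is_derive_const 0 t).
  - rewrite zsumR_S. apply (is_derive_ext (fun t => zsumR a l (fun k => G k t) + G (a + Z.of_nat l)%Z t)).
    + intros. now rewrite zsumR_S.
    + apply (is_derive_plus (fun t => zsumR a l (fun k => G k t))); [exact IH|apply H].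
Qed.

Definition cos_primitive (k : Z) (t : R) : R :=
  if Z.eq_dec k 0 then t else sin (IZR k * t) / IZR k.

Lemma is_derive_cos_primitive (k : Z) (t : R) : is_derive (cos_primitive k) t (cos (IZR k * t)).
Proof.
  unfold cos_primitive. destruct (Z.eq_dec k 0) as [->|Hk].
  - rewrite Rmult_0_l, cos_0. apply (is_derive_id t).
  - apply (not_0_IZR) in Hk. auto_derive; [exact I|]. field. exact Hk.
Qed.

Lemma cos_primitive_PI (k : Z) : cos_primitive k PI = if Z.eq_dec k 0 then PI else 0.
Proof.
  unfold cos_primitive. destruct (Z.eq_dec k 0) as [|Hk]; [reflexivity|].
  assert (E : sin (IZR k * PI) = 0) by (apply sin_eq_0_1; now exists k).
  rewrite E. unfold Rdiv. ring.
Qed.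

Lemma cos_primitive_0 (k : Z) : cos_primitive k 0 = 0.
Proof.
  unfold cos_primitive. destruct (Z.eq_dec k 0); [reflexivity|].
  rewrite Rmult_0_r, sin_0. unfold Rdiv. ring.
Qed.

Lemma fourier_cosine_coefficient (n m : nat) (s : Z -> R) :
  (forall j, s j = s (- j)%Z) -> (m <= n)%nat ->
  is_RInt_gen (fun x => cos_sum n s (acos x) * cos (INR m * acos x) / sqrt (1 - x^2))
    (at_right (-1)) (at_left 1) (PI * s (Z.of_nat m)).
Proof.
  intros Hs Hm.
  set (H := fun t => sym_sum n (fun j => s j / 2 *
     (cos_primitive (j - Z.of_nat m) t + cos_primitive (j + Z.of_nat m) t))).
  set (h := fun t => cos_sum n s t * cos (INR m * t)).
  assert (E : H PI - H 0 = PI * s (Z.of_nat m)).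
  { unfold H. unfold sym_sum. rewrite (zsumR_zero _ _ (fun j => _ * (cos_primitive _ 0 + _))).
    2:{ intros. rewrite !cos_primitive_0. ring. }
    rewrite Rminus_0_r.
    (* After the product-to-sum formula only [j = m] and [j = -m] survive. For [m = 0] both
       indicators select the same index, so the total is again [PI * s m]. *)
    transitivity (zsumR (- Z.of_nat n) (2 * n + 1) (fun j =>
      (if Z.eq_dec j (Z.of_nat m) then s j / 2 * PI else 0) +
      (if Z.eq_dec j (- Z.of_nat m) then s j / 2 * PI else 0))).
    - apply zsumR_ext. intros j _. rewrite !cos_primitive_PI.
      destruct (Z.eq_dec (j - Z.of_nat m) 0), (Z.eq_dec (j + Z.of_nat m) 0),
        (Z.eq_dec j (Z.of_nat m)), (Z.eq_dec j (- Z.of_nat m)); try lia; ring.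
    - rewrite zsumR_plus, !(zsumR_delta _ _ _ (fun j => s j / 2 * PI)) by lia.
      rewrite <- Hs. field. }
  rewrite <- E. apply (is_RInt_gen_acos h H).
  - intros t. unfold h, H.
    replace (cos_sum n s t * cos (INR m * t)) with (sym_sum n (fun j => s j / 2 *
      (cos (IZR (j - Z.of_nat m) * t) + cos (IZR (j + Z.of_nat m) * t)))).
    + apply is_derive_zsumR. intros j.
      apply (is_derive_scal (fun t => cos_primitive (j - Z.of_nat m) t + cos_primitive (j + Z.of_nat m) t)).
      apply (is_derive_plus (cos_primitive (j - Z.of_nat m)) (cos_primitive (j + Z.of_nat m)));
        apply is_derive_cos_primitive.
    + unfold cos_sum, sym_sum. rewrite Rmult_comm, <- zsumR_scal. apply zsumR_ext. intros j _.
      rewrite minus_IZR, plus_IZR, <- INR_IZR_INZ, Rmult_minus_distr_r, Rmult_plus_distr_r.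
      rewrite cos_minus, cos_plus. field.
  - intros t. unfold h. apply (continuous_mult (cos_sum n s) (fun t => cos (INR m * t))).
    + apply (ex_derive_continuous (cos_sum n s)). eexists.
      apply (is_derive_zsumR _ _ (fun k t => s k * cos (IZR k * t)) (fun k => s k * (- (IZR k * sin (IZR k * t))))).
      intros k. auto_derive; [exact I|]. ring.
    + apply (ex_derive_continuous (fun t => cos (INR m * t))). auto_derive. exact I.
Qed.

(** The integrands are compared on the open interval, where [1 - x] is nonzero and the quotient in
    [Sn] is genuine. *)
Lemma coef_cos_sum (n m : nat) (s : Z -> R) (p : R -> R) :
  (forall j, s j = s (- j)%Z) -> (m <= n)%nat ->
  (forall x, x <> 1 -> Sn n x = p x) -> (forall xi, p (cos xi) = cos_sum n s xi) ->
  coef n m = s (Z.of_nat m).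
Proof.
  intros Hs Hm HS Hp. unfold coef.
  rewrite (is_RInt_gen_unique _ (PI * s (Z.of_nat m))).
  - pose proof PI_RGT_0. field. lra.
  - apply (is_RInt_gen_ext (fun x => cos_sum n s (acos x) * cos (INR m * acos x) / sqrt (1 - x^2))).
    2:{ now apply fourier_cosine_coefficient. }
    generalize segments_in_open_interval. apply filter_imp. intros ab Hab x Hx.
    specialize (Hab x ltac:(lra)).
    rewrite <- Hp, <- chebT_cos, cos_acos, HS by lra. reflexivity.
Qed.

(** * From the polynomial extremal problem back to the operator norm *)

Lemma Re_fourier (n : nat) (u : Z -> R) (xi : R) : Re (fourier n u xi) = cos_sum n u xi.
Proof.
  unfold Re, fourier. rewrite zsumC_fst. apply zsumR_ext. intros k _. simpl.
  rewrite <- (cos_neg (IZR k * xi)), Ropp_mult_distr_l. ring.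
Qed.

Lemma cos_sum_at_0 (n : nat) (u : Z -> R) : cos_sum n u 0 = sym_sum n u.
Proof.
  apply zsumR_ext. intros k _. rewrite Rmult_0_r, cos_0. ring.
Qed.

Theorem theorem1p4 (n : nat) (u : Z -> R) :
  (0 < n)%nat ->
  (forall j : Z, (Z.abs j > Z.of_nat n)%Z -> u j = 0) ->
  (forall j : Z, u j = u (- j)%Z) ->
  sym_sum n u = 1 ->
  (forall xi : R, Im (fourier n u xi) = 0 /\ 0 <= Re (fourier n u xi)) ->
  Rbar_le (Finite (2^6 / (INR n + 2)^2 * (tan (PI / (2 * INR n + 4)))^2)) (opnorm4 n u) /\
  (opnorm4 n u = Finite (2^6 / (INR n + 2)^2 * (tan (PI / (2 * INR n + 4)))^2) <->
   forall m : nat, (m <= n)%nat ->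
     u (Z.of_nat m) = coef n m /\ u (- Z.of_nat m)%Z = coef n m).
Proof.
  intros _ _ Hu Hsum Hpos.
  replace (2^6 / (INR n + 2)^2 * (tan (PI / (2 * INR n + 4)))^2) with (8 * level n)
    by (unfold level; pose proof (n2_pos n); field; lra).
  assert (HU : forall xi, 0 <= cos_sum n u xi) by (intros; rewrite <- Re_fourier; apply Hpos).
  assert (HW : forall xi, 0 <= symbol n u xi).
  { intros xi. apply Rmult_le_pos; [|apply HU].
    apply Rmult_le_pos; [lra|apply pow2_ge_0]. }
  destruct (cos_sum_polyfun n u) as (p & Hp & Ep).
  destruct (Sn_polyfun n) as (q & Hq & Q1 & QS & QB).
  assert (P1 : p 1 = 1) by (transitivity (p (cos 0)); [now rewrite cos_0|now rewrite Ep, cos_sum_at_0]).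
  assert (Huniq : (forall xi, symbol n u xi <= 8 * level n) -> forall x, p x = q x).
  { intros Hle. apply (extremal_unique n p q Hp Hq P1 Q1 QB).
    intros x Hx. specialize (Hle (acos x)). unfold symbol in Hle.
    rewrite <- Ep, cos_acos in Hle by exact Hx. split; [|lra].
    rewrite <- (cos_acos x Hx), Ep. apply HU. }
  assert (Hattain : (forall x, p x = q x) -> Rbar_le (8 * level n) (opnorm4 n u)).
  { intros E.
    replace (8 * level n) with (symbol n u (acos (node n 1))).
    - now apply symbol_le_opnorm4.
    - unfold symbol. rewrite <- Ep, cos_acos, E by (apply node_bounds; lia).
      rewrite Rmult_assoc, QB, bump_node. ring. }
  assert (Hlow : Rbar_le (8 * level n) (opnorm4 n u)).
  (* A norm below [8 * level] would bound the symbol and force [p = q], for which the value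
     [8 * level] is attained. *)
  { destruct (Rbar_le_dec (8 * level n) (opnorm4 n u)) as [H|H]; [exact H|].
    apply Hattain, Huniq. intros xi.
    apply Rbar_not_le_lt, Rbar_lt_le in H.
    exact (Rbar_le_trans _ _ _ (symbol_le_opnorm4 n u xi Hu (HW xi)) H). }
  split; [exact Hlow|]. split.
  - intros Hop m Hm. rewrite <- Hu.
    assert (E : forall x, p x = q x).
    { apply Huniq. intros xi. pose proof (symbol_le_opnorm4 n u xi Hu (HW xi)) as H.
      rewrite Hop in H. exact H. }
    split; symmetry; apply (coef_cos_sum n m u q Hu Hm QS); intros xi; now rewrite <- E.
  (* The given integrals are the cosine coefficients [s] of [q], so the transform of [u] is
     [q (cos xi)] and the symbol is [4 * level * bump], at most [8 * level]. *)
  - intros Hc. destruct (polyfun_cos_sum n q Hq) as (s & Hs & _ & Es).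
    apply Rbar_le_antisym; [|exact Hlow].
    apply opnorm4_le; [exact Hu|]. intros xi. split; [apply HW|].
    assert (E : cos_sum n u xi = q (cos xi)).
    { rewrite Es. apply zsumR_ext. intros k Hk. f_equal.
      destruct (Hc (Z.abs_nat k)) as [H1 H2]; [lia|].
      rewrite (coef_cos_sum n _ s q Hs) in H1, H2 by (try assumption; lia).
      destruct (Z.le_gt_cases 0 k).
      - replace k with (Z.of_nat (Z.abs_nat k)) by lia. exact H1.
      - replace k with (- Z.of_nat (Z.abs_nat k))%Z by lia. rewrite <- Hs. exact H2. }
    unfold symbol. rewrite E, Rmult_assoc, QB.
    pose proof (bump_bounds n (cos xi) (COS_bound xi)). pose proof (level_pos n). nra.
Qed.
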